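(* Let $(X_n)_{n\ge 0}$ be a Galton--Watson process with immigration such that $X_0$, $\xi$ and $\varepsilon$ are regularly varying with index $\beta \in [1,\infty)$ (the same index for all three), $\mathbb{P}(\xi > x) = \mathrm{O}(\mathbb{P}(X_0 > x))$ as $x \to \infty$ and $\mathbb{P}(\xi > x) = \mathrm{O}(\mathbb{P}(\varepsilon > x))$ as $x \to \infty$. In case of $\beta = 1$, assume additionally that $\mathbb{E}(X_0) \in (0,\infty)$, $m_\xi \in (0,\infty)$ and $m_\varepsilon \in [0,\infty)$. Then for each $n \in \mathbb{N}$, we have $$\begin{aligned} \mathbb{P}(X_n > x) \sim{}& \mathbb{E}(X_0)\, m_\xi^{n-1} \sum_{i=0}^{n-1} m_\xi^{i(\beta-1)}\, \mathbb{P}(\xi > x) + m_\xi^{n\beta}\, \mathbb{P}(X_0 > x) \\ &+ m_\varepsilon \sum_{j=1}^{n-1} m_\xi^{n-j-1} \sum_{i=0}^{n-j-1} m_\xi^{i(\beta-1)}\, \mathbb{P}(\xi > x) + \sum_{j=1}^n m_\xi^{(n-j)\beta}\, \mathbb{P}(\varepsilon > x) \end{aligned}$$ as $x \to \infty$, and hence $X_n$ is also regularly varying with index $\beta$.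
   Context: A Galton--Watson process with immigration is a stochastic process $(X_n)_{n\ge 0}$ given by $X_n = \sum_{i=1}^{X_{n-1}} \xi_{n,i} + \varepsilon_n$, $n \ge 1$, where $\{X_0, \xi_{n,i}, \varepsilon_n : n,i \ge 1\}$ are independent non-negative integer-valued random variables, the $\xi_{n,i}$ ($n,i\ge1$) are identically distributed, the $\varepsilon_n$ ($n\ge 1$) are identically distributed, and $\sum_{i=1}^0 := 0$. Here $\xi$ and $\varepsilon$ denote random variables with the distribution of $\xi_{1,1}$ and $\varepsilon_1$, respectively, and $m_\xi := \mathbb{E}(\xi) \in [0,\infty]$, $m_\varepsilon := \mathbb{E}(\varepsilon) \in [0,\infty]$. Empty sums are $0$; $\mathbb{N} = \{1,2,\ldots\}$. A non-negative random variable $X$ is regularly varying with index $\alpha \in [0,\infty)$ if $\mathbb{P}(X > x) > 0$ for all $x > 0$ and $\lim_{x\to\infty} \mathbb{P}(X > qx)/\mathbb{P}(X > x) = q^{-\alpha}$ for all $q > 0$. $f(x) \sim g(x)$ as $x\to\infty$ means $\lim_{x\to\infty} f(x)/g(x) = 1$, and $f(x) = \mathrm{O}(g(x))$ as $x\to\infty$ means $\limsup_{x\to\infty} f(x)/g(x) < \infty$. *)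

(* Defs.v *)
From HB Require Import structures.
From mathcomp Require Import all_boot all_order all_algebra finmap.
From mathcomp Require Import all_classical all_reals all_analysis.

Set Implicit Arguments.
Unset Strict Implicit.
Unset Printing Implicit Defensive.

Import Order.TTheory GRing.Theory Num.Theory.
Import numFieldNormedType.Exports.

Local Open Scope classical_set_scope.
Local Open Scope ring_scope.

Section asymptotics.
Context {R : realType}.
Implicit Types f g : R -> R.

Definition asymp_equiv f g : Prop := f x / g x @[x --> +oo] --> (1 : R).

Definition asymp_bigO f g : Prop :=
  (limf_esup (fun x => (f x / g x)%:E) (pinfty_nbhs R) < +oo)%E.

End asymptotics.

Section random_variables.
Context {d : measure_display} {T : measurableType d} {R : realType}
  {P : probability T R}.

(* [{RV P >-> nat}] uses the discrete sigma-algebra on [nat]. *)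
Definition natr_comp (Y : T -> nat) : T -> R := fun w => (Y w)%:R.

Lemma measurable_natr_comp (Y : {RV P >-> nat}) :
  measurable_fun setT (natr_comp Y).
Proof.
by apply: (measurableT_comp (f := fun n : nat => n%:R : R)).
Qed.

HB.instance Definition _ (Y : {RV P >-> nat}) :=
  isMeasurableFun.Build _ _ _ _ (natr_comp Y) (measurable_natr_comp Y).

Definition realRV (Y : {RV P >-> nat}) : {RV P >-> R} := natr_comp Y.

(* A probability is finite, so [fine] loses nothing here. *)
Definition tail (Y : {RV P >-> R}) (x : R) : R := fine (ccdf Y x).

(* Only meaningful for a finite expectation: [fine] sends [+oo] to [0].
   Regular variation with index > 1 entails finiteness; it has to be assumed
   for index 1. *)
Definition mean (Y : {RV P >-> R}) : R := fine 'E_P[Y]%E.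

Definition regularly_varying (Y : {RV P >-> R}) (alpha : R) : Prop :=
  [/\ 0 <= alpha,
      forall w, 0 <= Y w,
      forall x, 0 < x -> 0 < tail Y x &
      forall q, 0 < q ->
        tail Y (q * x) / tail Y x @[x --> +oo] --> q `^ (- alpha)].

Definition mutually_independent {I : choiceType} {d' : measure_display}
    {T' : measurableType d'} (Y : I -> {RV P >-> T'}) : Prop :=
  forall (J : {fset I}) (A : I -> set T'), (forall i, measurable (A i)) ->
    P (\bigcap_(i in [set` J]) (Y i @^-1` A i)) =
    (\prod_(i <- J) P (Y i @^-1` A i))%E.

(* The family X_0, xi_{n,i}, eps_n with n, i >= 1; the entries of [xi] and
   [eps] with a zero index play no role. *)
Definition gwi_family (X0 : {RV P >-> nat}) (xi : nat -> nat -> {RV P >-> nat})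
    (eps : nat -> {RV P >-> nat}) (k : unit + nat * nat + nat) :
    {RV P >-> nat} :=
  match k with
  | inl (inl _) => X0
  | inl (inr (n, i)) => xi n.+1 i.+1
  | inr n => eps n.+1
  end.

Record galton_watson_immigration (X : nat -> {RV P >-> nat})
    (xi : nat -> nat -> {RV P >-> nat}) (eps : nat -> {RV P >-> nat}) : Prop := {
  gwi_independent : mutually_independent (gwi_family (X 0%N) xi eps) ;
  gwi_offspring_id : forall n i A, (0 < n)%N -> (0 < i)%N ->
    distribution P (xi n i) A = distribution P (xi 1%N 1%N) A ;
  gwi_immigration_id : forall n A, (0 < n)%N ->
    distribution P (eps n) A = distribution P (eps 1%N) A ;
  gwi_rec : forall n w, (0 < n)%N ->
    X n w = (\sum_(1 <= i < (X n.-1 w).+1) xi n i w + eps n w)%N }.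

End random_variables.

(* Main.v *)
Require Import Defs.
From HB Require Import structures.
From mathcomp Require Import all_boot all_order all_algebra finmap.
From mathcomp Require Import all_classical all_reals all_analysis.
From mathcomp Require Import ring lra zify.
Import Order.TTheory GRing.Theory Num.Theory.
Import numFieldNormedType.Exports.
Local Open Scope classical_set_scope.
Local Open Scope ring_scope.

(** Each generation is a random sum plus immigration: given [X_n = a], the next
    generation is a sum of [a] independent offspring numbers, to which an
    independent immigration number is added. So the theorem follows by induction
    on [n] from two facts about regularly varying tails of the same index.

    - For independent summands, [P(A + B > x) ~ P(A > x) + P(B > x)]: one big
      jump ([asymp_tl_convol]).
    - For a sum [S_N] of [N] independent terms of mean [m], where [N] has a finite
      mean, [P(S_N > x) ~ E(N) P(xi > x) + m^beta P(N > x)]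
      ([asymp_tl_random_sum]): either one term is exceptionally large, or there
      are about [x / m] terms, and then the law of large numbers does the rest.

    The second fact rests on the uniform bound [P(S_k > x) <= C k P(xi > x)] for
    [k m <= (1 - d) x] ([large_deviation]), which shows that the intermediate
    values of [N] contribute little. It is a Chernoff bound for the terms
    truncated at a small multiple of [x]. It uses the tail of [xi] only through
    a doubling property, and the mean only through [x P(xi > x) -> 0], so the
    index [1] with a finite mean is treated together with the larger indices.

    All estimates are made on laws, seen as sequences [p : nat -> R] of real
    numbers: the sum of [k] terms has the law [convpow p k], whose values are
    coefficients of powers of truncated generating polynomials, so that only
    finite sums occur. The passage from random variables to laws
    ([indep_off_random_sum]) decomposes events along the values of the
    variables, and uses that an event determined by some of the variables is
    independent of the others ([indep_off]).

    The recursion [X_{n+1} ~ E(X_n) xi + m^beta X_n + eps] between tails is solved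
    by the closed form of the statement ([gwi_tailS]); the means follow
    [E(X_{n+1}) = m E(X_n) + m_eps] ([has_mean_mixture], [has_mean_convol]), and
    are finite for an index above [1] because the tails then decay geometrically
    along powers of [2] ([regvar_has_mean]). *)

Set Implicit Arguments.
Unset Strict Implicit.
Unset Printing Implicit Defensive.

(** * Asymptotic equivalence and regular variation at infinity *)

Section asymptotic_equivalence.
Context {R : realType}.
Implicit Types (f g h : R -> R) (x e c q beta : R).

(** Asymptotic equivalence, written without a quotient: [g] may vanish, so the
    equivalences below remain meaningful for terms with a zero coefficient, and
    they can be added without looking at signs. *)
Definition asymp f g :=
  forall e, 0 < e -> \forall x \near +oo, `|f x - g x| <= e * g x.

Lemma asymp_ge0 f g : asymp f g -> \forall x \near +oo, 0 <= g x.
Proof.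
move=> fg; move: (fg 1 ltr01); apply: filterS => x; rewrite mul1r.
exact: le_trans.
Qed.

Lemma asymp_refl f : (\forall x \near +oo, 0 <= f x) -> asymp f f.
Proof.
move=> f0 e e0; move: f0; apply: filterS => x fx.
by rewrite subrr normr0 mulr_ge0// ltW.
Qed.

Lemma asymp_sym f g : asymp f g -> asymp g f.
Proof.
move=> fg e e0; pose d := Num.min (1 / 2) (e / 2).
have d0 : 0 < d by rewrite lt_min divr_gt0 ?divr_gt0.
have d2 : d <= 1 / 2 by rewrite ge_min lexx.
have de : d <= e / 2 by rewrite ge_min lexx orbT.
move: (fg d d0) (asymp_ge0 fg); apply: filterS2 => x.
rewrite distrC => dx gx; have := dx; rewrite ler_distl => /andP[_ gf].
have gf2 : g x <= 2 * f x by nra.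
apply: (le_trans dx); nra.
Qed.

Lemma asymp_trans f g h : asymp f g -> asymp g h -> asymp f h.
Proof.
move=> fg gh e e0; pose d := Num.min 1 (e / 3).
have d0 : 0 < d by rewrite lt_min ltr01 divr_gt0.
have d1 : d <= 1 by rewrite ge_min lexx.
have de : d <= e / 3 by rewrite ge_min lexx orbT.
move: (fg d d0) (gh d d0) (asymp_ge0 gh); apply: filterS3 => x fgx ghx hx.
have := ghx; rewrite ler_distl => /andP[_ gh1].
apply: (le_trans (ler_distD (g x) _ _)).
apply: (le_trans (lerD fgx ghx)).
have g2 : g x <= 2 * h x by nra.
have : d * g x <= d * (2 * h x) by rewrite ler_wpM2l// ltW.
nra.
Qed.

Lemma asympD f1 g1 f2 g2 : asymp f1 g1 -> asymp f2 g2 ->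
  asymp (fun x => f1 x + f2 x) (fun x => g1 x + g2 x).
Proof.
move=> fg1 fg2 e e0; move: (fg1 e e0) (fg2 e e0); apply: filterS2 => x h1 h2.
rewrite mulrDr opprD addrACA.
exact: le_trans (ler_normD _ _) (lerD h1 h2).
Qed.

Lemma asympZ c f g : 0 <= c -> asymp f g ->
  asymp (fun x => c * f x) (fun x => c * g x).
Proof.
move=> c0 fg e e0; move: (fg e e0); apply: filterS => x h.
by rewrite -mulrBr normrM (ger0_norm c0) mulrCA ler_wpM2l.
Qed.

Lemma near_pinftyM q (P : R -> Prop) : 0 < q ->
  (\forall x \near +oo, P x) -> \forall x \near +oo, P (q * x).
Proof.
move=> q0 [M [Mr MP]]; exists (M / q); split; first exact: num_real.
by move=> x; rewrite ltr_pdivrMr// mulrC => /MP.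
Qed.

Lemma asymp_scale q f g : 0 < q -> asymp f g ->
  asymp (fun x => f (q * x)) (fun x => g (q * x)).
Proof. by move=> q0 fg e e0; apply: near_pinftyM q0 (fg e e0). Qed.

Lemma asymp_eqr f g h : g =1 h -> asymp f g -> asymp f h.
Proof. by move=> /funext ->. Qed.

Lemma asymp_eql f g h : f =1 h -> asymp f g -> asymp h g.
Proof. by move=> /funext ->. Qed.

Lemma asymp_near f g h : (\forall x \near +oo, f x = h x) ->
  asymp f g -> asymp h g.
Proof.
by move=> fh fg e e0; move: fh (fg e e0); apply: filterS2 => x ->.
Qed.

Lemma asymp_equivP f g : (\forall x \near +oo, 0 < g x) ->
  asymp f g <-> asymp_equiv f g.
Proof.
move=> g0; split => fg.
  apply/cvgrPdist_le => e e0; move: (fg e e0) g0; apply: filterS2 => x fgx gx.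
  rewrite -[1](@divff _ (g x)) ?gt_eqF// -mulrBl normrM normfV (gtr0_norm gx).
  by rewrite ler_pdivrMr// distrC.
move=> e e0; move/cvgrPdist_le: fg => /(_ e e0) fg.
move: fg g0; apply: filterS2 => x; rewrite distrC => fgx gx.
have -> : f x - g x = (f x / g x - 1) * g x.
  by rewrite mulrBl mul1r mulfVK// gt_eqF.
by rewrite normrM (gtr0_norm gx) ler_wpM2r// ltW.
Qed.

Lemma eq_asymp_equiv f f' g g' :
  (\forall x \near +oo, f x = f' x) -> (\forall x \near +oo, g x = g' x) ->
  asymp_equiv f g -> asymp_equiv f' g'.
Proof.
move=> ff gg; apply: cvg_trans; apply: near_eq_cvg.
by move: ff gg; apply: filterS2 => x -> ->.
Qed.

(** No positivity is asked, so that this class is closed under nonnegative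
    linear combinations, the zero function included. *)
Definition regvar f beta :=
  forall q, 0 < q -> asymp (fun x => f (q * x)) (fun x => q `^ (- beta) * f x).

Lemma regvarD f g beta : regvar f beta -> regvar g beta ->
  regvar (fun x => f x + g x) beta.
Proof.
move=> rf rg q q0.
apply: asymp_eqr (asympD (rf q q0) (rg q q0)) => x.
by rewrite mulrDr.
Qed.

Lemma regvarZ c f beta : 0 <= c -> regvar f beta ->
  regvar (fun x => c * f x) beta.
Proof.
move=> c0 rf q q0.
by apply: asymp_eqr (asympZ c0 (rf q q0)) => x; rewrite mulrCA.
Qed.

Lemma regvar_asymp f g beta : asymp f g -> regvar g beta -> regvar f beta.
Proof.
move=> fg rg q q0.
apply: (asymp_trans (asymp_scale q0 fg)).
apply: asymp_trans (rg q q0) _.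
exact: asympZ (powR_ge0 _ _) (asymp_sym fg).
Qed.

Lemma regvarP f beta : (\forall x \near +oo, 0 < f x) ->
  regvar f beta <->
  forall q, 0 < q -> f (q * x) / f x @[x --> +oo] --> q `^ (- beta).
Proof.
move=> f0; split => rf q q0; have w0 := powR_gt0 (- beta) q0.
  apply/cvgrPdist_le => e e0.
  have ew : 0 < e / q `^ (- beta) by rewrite divr_gt0.
  move: (rf q q0 _ ew) f0; apply: filterS2 => x.
  rewrite mulrA mulfVK ?gt_eqF// => fx f1.
  have -> : q `^ (- beta) - f (q * x) / f x =
     - ((f (q * x) - q `^ (- beta) * f x) / f x).
    by rewrite mulrBl mulfK ?gt_eqF// opprB.
  by rewrite normrN normrM normfV (gtr0_norm f1) ler_pdivrMr.
move=> e e0; move/cvgrPdist_le : (rf q q0) => /(_ _ (mulr_gt0 e0 w0)) rq.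
move: rq f0; apply: filterS2 => x fx f1.
have -> : f (q * x) - q `^ (- beta) * f x =
    - ((q `^ (- beta) - f (q * x) / f x) * f x).
  by rewrite mulrBl mulfVK ?gt_eqF// opprB.
by rewrite normrN normrM (gtr0_norm f1) mulrA ler_wpM2r// ltW.
Qed.

Lemma asymp_le f g e : asymp f g -> 0 < e ->
  \forall x \near +oo, f x <= (1 + e) * g x.
Proof.
move=> fg e0; move: (fg e e0); apply: filterS => x.
by rewrite ler_distl => /andP[_]; rewrite mulrDl mul1r.
Qed.

Lemma asymp_ge f g e : asymp f g -> 0 < e ->
  \forall x \near +oo, (1 - e) * g x <= f x.
Proof.
move=> fg e0; move: (fg e e0); apply: filterS => x.
by rewrite ler_distl => /andP[h _]; rewrite mulrBl mul1r.
Qed.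

(** The shape in which asymptotic statements are proved below: matching upper
    and lower bounds, each up to an arbitrary relative error. *)
Lemma asymp_sandwich f g :
  (forall e, 0 < e -> e < 1 -> \forall x \near +oo, f x <= (1 + e) * g x) ->
  (forall e, 0 < e -> e < 1 -> \forall x \near +oo, (1 - e) * g x <= f x) ->
  (\forall x \near +oo, 0 <= g x) ->
  asymp f g.
Proof.
move=> ub lb g0 e e0; pose d := Num.min (1 / 2) e.
have d0 : 0 < d by rewrite lt_min divr_gt0 ?e0.
have d1 : d < 1 by rewrite gt_min; apply/orP; left; lra.
have de : d <= e by rewrite ge_min lexx orbT.
move: (ub d d0 d1) (lb d d0 d1) g0; apply: filterS3 => x fu fl gx.
rewrite ler_distl; apply/andP; split; nra.
Qed.

(** What one pays for shifting the argument of a regularly varying tail by a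
    factor [1 - d] or [1 + d]. *)
Lemma powR_near1 beta e : 0 < e -> exists2 d, 0 < d <= 1 / 2 &
  (1 - d) `^ (- beta) <= 1 + e /\ 1 - e <= (1 + d) `^ (- beta).
Proof.
move=> e0.
have : {for 1, continuous (fun q : R => q `^ (- beta))}.
  apply: differentiable_continuous; apply/derivable1_diffP.
  by apply: derivable_powR; rewrite in_itv/= ltr01.
move/cvgrPdist_le => /(_ e e0)[d /= d0 dP].
exists (Num.min (1 / 2) (d / 2)).
  by rewrite lt_min divr_gt0//= divr_gt0//= ge_min lexx.
set c := Num.min _ _.
have c0 : 0 < c by rewrite lt_min divr_gt0//= divr_gt0.
have cd : c < d by rewrite gt_min; apply/orP; right; lra.
have P1 q : `|1 - q| < d -> `|1 - q `^ (- beta)| <= e.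
  by move=> /dP; rewrite powR1.
split.
  have /P1 : `|1 - (1 - c)| < d by rewrite opprB addrCA subrr addr0 gtr0_norm.
  by rewrite ler_distlC => /andP[].
have /P1 : `|1 - (1 + c)| < d by rewrite opprD addNKr normrN gtr0_norm.
by rewrite ler_distlC => /andP[].
Qed.

End asymptotic_equivalence.

(** * Laws on the natural numbers, their tails and convolution *)

Section discrete_laws.
Context {R : realType}.
Implicit Types (p a b : nat -> R) (x y e s t : R).

Definition is_law p := (forall j, 0 <= p j) /\ series p @ \oo --> (1 : R).

(** The tail of a law at a real point [x >= 0]; the sum runs over the integers
    [j <= x]. *)
Definition tl p x := 1 - \sum_(0 <= j < (Num.truncn x).+1) p j.

Lemma le_psum p m n : (forall j, 0 <= p j) -> (m <= n)%N ->
  \sum_(0 <= j < m) p j <= \sum_(0 <= j < n) p j.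
Proof.
move=> p0 mn; rewrite [leRHS](@big_cat_nat _ _ _ m)//= lerDl.
exact: sumr_ge0.
Qed.

Lemma psum_ge0 p n : (forall j, 0 <= p j) -> 0 <= \sum_(0 <= j < n) p j.
Proof. by move=> p0; apply: sumr_ge0. Qed.

Lemma le_psum_lim p l n : (forall j, 0 <= p j) -> series p @ \oo --> l ->
  \sum_(0 <= j < n) p j <= l.
Proof.
move=> p0 pl; rewrite -(cvg_lim _ pl)//.
apply: (@nondecreasing_cvgn_le _ (series p)); last by apply/cvg_ex; exists l.
by move=> i j; exact: le_psum.
Qed.

Lemma cvg_sum_seq (c : nat -> nat -> R) (l : nat -> R) n :
  (forall i, c i @ \oo --> l i) ->
  (fun k => \sum_(0 <= i < n) c i k) @ \oo --> \sum_(0 <= i < n) l i.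
Proof.
move=> cl; elim: n => [|n IH].
  rewrite big_nil (_ : (fun _ => _) = cst 0); first exact: cvg_cst.
  by apply/funext => k; rewrite big_nil.
rewrite big_nat_recr//=.
under eq_fun do rewrite big_nat_recr//=.
by apply: cvgD => //; exact: cl.
Qed.

Lemma psum_near_lim p l e : (forall j, 0 <= p j) -> series p @ \oo --> l ->
  0 < e -> \forall n \near \oo, l - e <= \sum_(0 <= j < n) p j.
Proof.
move=> p0 /cvgrPdist_le/[apply]; apply: filterS => n.
by rewrite ler_distlC => /andP[].
Qed.

Lemma cvg_psum p l : (forall n, \sum_(0 <= j < n) p j <= l) ->
  (forall j, 0 <= p j) ->
  (forall e, 0 < e -> exists n, l - e <= \sum_(0 <= j < n) p j) ->
  series p @ \oo --> l.
Proof.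
move=> pl p0 lp; apply/cvgrPdist_le => e e0; have [N lN] := lp e e0.
exists N => // n /= Nn; rewrite ler_distlC; apply/andP; split.
  exact/(le_trans lN)/le_psum.
by apply: (le_trans (pl n)); rewrite lerDl ltW.
Qed.

Lemma psum_le1 p n : is_law p -> \sum_(0 <= j < n) p j <= 1.
Proof. by move=> [p0]; exact: le_psum_lim. Qed.

Lemma tl_ge0 p x : is_law p -> 0 <= tl p x.
Proof. by move=> pp; rewrite subr_ge0 psum_le1. Qed.

Lemma tl_le1 p x : is_law p -> tl p x <= 1.
Proof. by move=> [p0 _]; rewrite lerBlDr lerDl psum_ge0. Qed.

Lemma tl_nonincr p x y : is_law p -> x <= y -> tl p y <= tl p x.
Proof.
by move=> [p0 _] xy; rewrite lerD2l lerN2 le_psum// ltnS le_truncn.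
Qed.

Lemma tl_gt0_near p : is_law p ->
  (\forall x \near +oo, 0 < tl p x) -> forall x, 0 < tl p x.
Proof.
move=> pl [M [_ MP]] x; apply: (@lt_le_trans _ _ (tl p (Num.max x M + 1))).
  by apply: MP; rewrite ltr_pwDr// le_max lexx orbT.
by apply: tl_nonincr => //; rewrite ler_wpDr// le_max lexx.
Qed.

Lemma near_truncn (P : nat -> Prop) :
  (\forall n \near \oo, P n) -> \forall x \near +oo, P (Num.truncn (x : R)).+1.
Proof.
move=> [N _ NP]; exists N%:R; split; first exact: num_real.
move=> x /ltW Nx; apply: NP => /=.
by rewrite leqW// truncn_ge_nat// (le_trans _ Nx).
Qed.

Lemma tl_near0 p e : is_law p -> 0 < e -> \forall x \near +oo, tl p x <= e.
Proof.
move=> [p0 p1] e0; move: (near_truncn (psum_near_lim p0 p1 e0)).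
by apply: filterS => x; rewrite /tl; lra.
Qed.

Definition convol a b u := \sum_(z < u.+1) a z * b (u - z)%N.

Lemma convol_ge0 a b u : (forall j, 0 <= a j) -> (forall j, 0 <= b j) ->
  0 <= convol a b u.
Proof. by move=> a0 b0; apply: sumr_ge0 => i _; rewrite mulr_ge0. Qed.

Lemma psum_convol a b n : \sum_(0 <= u < n) convol a b u =
  \sum_(0 <= z < n) a z * \sum_(0 <= w < n - z) b w.
Proof.
elim: n => [|n IH]; first by rewrite !big_nil.
rewrite big_nat_recr//= {}IH [in RHS]big_nat_recr//= subSnn big_nat1.
rewrite /convol -(big_mkord xpredT (fun z => a z * b (n - z)%N)).
rewrite big_nat_recr//= subnn addrA; congr (_ + _).
rewrite -big_split/=; apply: eq_big_nat => z /andP[_ zn].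
by rewrite subSn 1?ltnW// big_nat_recr//= mulrDr.
Qed.

Lemma psum_convol_le a b n : (forall j, 0 <= a j) -> (forall j, 0 <= b j) ->
  \sum_(0 <= u < n) convol a b u <=
  (\sum_(0 <= z < n) a z) * (\sum_(0 <= w < n) b w).
Proof.
move=> a0 b0; rewrite psum_convol mulr_suml; apply: ler_sum => z _.
by rewrite ler_wpM2l// le_psum// leq_subr.
Qed.

(** The triangle [z + w < n] contains the union of the two rectangles [i] by [j]
    and [j] by [i]; the left-hand side is the mass of this union. *)
Lemma psum_convol_ge a b i j n : (forall j, 0 <= a j) -> (forall j, 0 <= b j) ->
  (i <= j)%N -> (i + j <= n.+1)%N -> (j <= n)%N ->
  let A k := \sum_(0 <= z < k) a z in
  let B k := \sum_(0 <= z < k) b z in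
  A i * B j + (A j - A i) * B i <= \sum_(0 <= u < n) convol a b u.
Proof.
move=> a0 b0 ij ijn jn; cbv zeta; rewrite psum_convol.
set A := fun k => \sum_(0 <= z < k) a z; set B := fun k => \sum_(0 <= z < k) b z.
rewrite -/(A i) -/(A j) -/(B i) -/(B j).
have -> : A j - A i = \sum_(i <= z < j) a z.
  by rewrite /A (@big_cat_nat _ _ _ i)//= addrAC subrr add0r.
rewrite [leRHS](@big_cat_nat _ _ _ j)//=.
rewrite [X in _ <= X + _](@big_cat_nat _ _ _ i)//=.
rewrite -[leLHS]addr0 lerD//; last first.
  by apply: sumr_ge0 => z _; rewrite mulr_ge0 ?psum_ge0.
by apply: lerD; rewrite mulr_suml; apply: ler_sum_nat => z /andP[zi zj];
  rewrite ler_wpM2l// le_psum//; lia.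
Qed.

(** Cauchy product: the triangle of indices [z + w < 2 N] contains the square of
    side [N], whose sum tends to [A * B]. *)
Lemma series_convol a b (A B : R) : (forall j, 0 <= a j) -> (forall j, 0 <= b j) ->
  series a @ \oo --> A -> series b @ \oo --> B ->
  series (convol a b) @ \oo --> A * B.
Proof.
move=> a0 b0 aA bB; apply: cvg_psum => [n|j|e e0].
- apply: (le_trans (psum_convol_le n a0 b0)).
  by apply: ler_pM; rewrite ?psum_ge0//; exact: le_psum_lim.
- exact: convol_ge0.
- have /cvgrPdist_le/(_ e e0)[N _ /(_ N (leqnn _))] :
      (fun n => series a n * series b n) @ \oo --> A * B by exact: cvgM.
  rewrite /= ler_distlC => /andP[AB _]; exists (N + N)%N; apply: (le_trans AB).
  have := psum_convol_ge a0 b0 (leqnn N) (leqnSn (N + N)) (leq_addr N N).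
  by rewrite /= subrr mul0r addr0.
Qed.

Lemma law_convol a b : is_law a -> is_law b -> is_law (convol a b).
Proof.
move=> [a0 a1] [b0 b1]; split=> [j|]; first exact: convol_ge0.
by rewrite -[1]mulr1; exact: series_convol.
Qed.

(** A sum exceeds [x] as soon as one summand does. *)
Lemma tl_convol_ge a b x : is_law a -> is_law b ->
  tl a x + tl b x - tl a x * tl b x <= tl (convol a b) x.
Proof.
move=> [a0 _] [b0 _]; have := psum_convol_le (Num.truncn x).+1 a0 b0.
by rewrite /tl; lra.
Qed.

(** If a sum exceeds [x], then either one summand exceeds [(1 - d) x], or both
    exceed [d x]. *)
Lemma tl_convol_le a b x d : is_law a -> is_law b -> 0 <= x -> 0 < d <= 1 / 2 ->
  tl (convol a b) x <=
  tl a ((1 - d) * x) + tl b ((1 - d) * x) + tl a (d * x) * tl b (d * x).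
Proof.
move=> pa pb x0 /andP[d0 d2]; have [a0 _] := pa; have [b0 _] := pb.
have dx : d * x <= (1 - d) * x by rewrite ler_wpM2r//; lra.
have dx0 : 0 <= d * x by rewrite mulr_ge0// ltW.
have dx1 : 0 <= (1 - d) * x by rewrite mulr_ge0//; lra.
have xx : (1 - d) * x <= x by rewrite ler_piMl//; lra.
have ij : ((Num.truncn (d * x)).+1 + (Num.truncn ((1 - d) * x)).+1 <=
    (Num.truncn x).+2)%N.
  rewrite addSn addnS !ltnS truncn_ge_nat// natrD.
  apply: (@le_trans _ _ (d * x + (1 - d) * x)); last by lra.
  by rewrite lerD// truncn_le.
have /= := psum_convol_ge a0 b0 (le_truncn dx : (_.+1 <= _.+1)%N) ij
  (le_truncn xx : (_.+1 <= _.+1)%N).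
have := tl_ge0 (d * x) pa; have := tl_ge0 (d * x) pb.
have := tl_ge0 ((1 - d) * x) pa; have := tl_ge0 ((1 - d) * x) pb.
have := tl_nonincr pa dx; have := tl_nonincr pb dx.
rewrite /tl; nra.
Qed.

(** One big jump: in [tl_convol_le] the product of the two tails is negligible
    because one factor tends to [0] while the other stays comparable to the
    tail at [x]. *)
Lemma asymp_tl_convol a b f g beta : is_law a -> is_law b ->
  regvar f beta -> regvar g beta -> asymp (tl a) f -> asymp (tl b) g ->
  asymp (tl (convol a b)) (fun x => f x + g x).
Proof.
move=> pa pb rf rg af bg.
apply: asymp_sandwich => [e e0 e1|e e0 e1|]; last 1 first.
- by move: (asymp_ge0 af) (asymp_ge0 bg); apply: filterS2 => x; exact: addr_ge0.
- have e4 : 0 < e / 4 by rewrite divr_gt0.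
  have [d dP [dl _]] := powR_near1 beta e4.
  have /andP[d0 d2] := dP.
  have d1 : 0 < 1 - d by lra.
  have w0 := powR_gt0 (- beta) d0.
  have af1 := asymp_le (asymp_trans (asymp_scale d1 af) (rf _ d1)) e4.
  have bg1 := asymp_le (asymp_trans (asymp_scale d1 bg) (rg _ d1)) e4.
  have bg2 := asymp_le (asymp_trans (asymp_scale d0 bg) (rg _ d0)) ltr01.
  have eta0 : 0 < e / 4 / (2 * d `^ (- beta)) by rewrite divr_gt0// mulr_gt0.
  have a2 := near_pinftyM d0 (tl_near0 pa eta0).
  near=> x.
  have x0 : 0 <= x by near: x; exact: nbhs_pinfty_ge.
  have fx : 0 <= f x by near: x; exact: asymp_ge0 af.
  have gx : 0 <= g x by near: x; exact: asymp_ge0 bg.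
  apply: (le_trans (tl_convol_le pa pb x0 dP)).
  have h1 : tl a ((1 - d) * x) <= (1 + 3 * (e / 4)) * f x.
    apply: (@le_trans _ _ ((1 + e / 4) * ((1 - d) `^ (- beta) * f x))).
      by near: x.
    rewrite mulrA ler_wpM2r//.
    by apply: (@le_trans _ _ ((1 + e / 4) * (1 + e / 4))); nra.
  have h2 : tl b ((1 - d) * x) <= (1 + 3 * (e / 4)) * g x.
    apply: (@le_trans _ _ ((1 + e / 4) * ((1 - d) `^ (- beta) * g x))).
      by near: x.
    rewrite mulrA ler_wpM2r//.
    by apply: (@le_trans _ _ ((1 + e / 4) * (1 + e / 4))); nra.
  have h3 : tl a (d * x) * tl b (d * x) <= e / 4 * g x.
    have -> : e / 4 * g x =
        e / 4 / (2 * d `^ (- beta)) * ((1 + 1) * (d `^ (- beta) * g x)).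
      by field; rewrite gt_eqF.
    apply: ler_pM; rewrite ?tl_ge0//; first by near: x; exact: a2.
    by near: x.
  by nra.
- have e2 : 0 < e / 2 by rewrite divr_gt0.
  near=> x.
  have fx : 0 <= f x by near: x; exact: asymp_ge0 af.
  have gx : 0 <= g x by near: x; exact: asymp_ge0 bg.
  apply: le_trans (tl_convol_ge x pa pb).
  have h1 : (1 - e / 2) * f x <= tl a x by near: x; exact: asymp_ge af e2.
  have h2 : (1 - e / 2) * g x <= tl b x by near: x; exact: asymp_ge bg e2.
  have h3 : tl a x <= e / 2 by near: x; exact: tl_near0.
  have := tl_ge0 x pb; nra.
Unshelve. all: by end_near. Qed.

End discrete_laws.

(** * Convolution powers and Chernoff bounds *)

Section convolution_powers.
Context {R : realType}.
Implicit Types (p a b : nat -> R) (x y e s t : R) (q : {poly R}).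

Fixpoint convpow p k : nat -> R :=
  if k is k'.+1 then convol (convpow p k') p else fun u => (u == 0)%:R.

Lemma law_dirac0 : is_law (fun u => (u == 0)%:R : R).
Proof.
have sum1 n : \sum_(0 <= j < n.+1) ((j == 0)%:R : R) = 1.
  by rewrite big_nat_recl//= big1 ?addr0.
split=> [j|]; first exact: ler0n.
apply/cvgrPdist_le => e e0; exists 1 => // -[//|n] _.
by rewrite /series/= sum1 subrr normr0 ltW.
Qed.

Lemma law_convpow p k : is_law p -> is_law (convpow p k).
Proof.
by move=> pp; elim: k => [|k IH] /=; [exact: law_dirac0|exact: law_convol].
Qed.

Lemma tl_convpow0 p x : tl (convpow p 0) x = 0.
Proof. by rewrite /tl/= big_nat_recl//= big1 ?addr0 ?subrr. Qed.

Lemma asymp_tl_convpow p k beta : is_law p -> regvar (tl p) beta ->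
  asymp (tl (convpow p k)) (fun x => k%:R * tl p x).
Proof.
move=> pp rp; elim: k => [|k IH].
  apply: (@asymp_eql _ (fun=> 0)) => [x|]; first by rewrite tl_convpow0.
  apply: (@asymp_eqr _ _ (fun=> 0)) => [x|]; first by rewrite mul0r.
  by apply: asymp_refl; near=> x.
have pk := law_convpow k pp.
have pp1 : asymp (tl p) (tl p).
  by apply: asymp_refl; near=> x; rewrite tl_ge0.
have := asymp_tl_convol pk pp (regvarZ (ler0n _ k) rp) rp IH pp1.
by apply: asymp_eqr => x; rewrite -[in RHS]natr1 mulrDl mul1r.
Unshelve. all: by end_near. Qed.

(** Truncating a law at [n] turns its generating function into a polynomial,
    whose powers carry the convolution powers of the law below degree [n]. *)
Definition genpoly p n : {poly R} := \poly_(j < n) p j.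

Lemma coef_genpoly p n k u : (u < n)%N -> ((genpoly p n) ^+ k)`_u = convpow p k u.
Proof.
move=> un; elim: k u un => [|k IH] u un; first by rewrite expr0 coef1.
rewrite exprSr coefM /= /convol; apply: eq_bigr => -[z /= zu] _.
rewrite IH ?coef_poly; last by lia.
by rewrite ifT//; lia.
Qed.

Lemma horner_genpoly p n t :
  (genpoly p n).[t] = \sum_(0 <= j < n) p j * t ^+ j.
Proof. by rewrite horner_poly big_mkord. Qed.

Lemma coef_exp_ge0 q k u : (forall j, 0 <= q`_j) -> 0 <= (q ^+ k)`_u.
Proof.
move=> q0; elim: k u => [|k IH] u; first by rewrite expr0 coef1 ler0n.
by rewrite exprSr coefM; apply: sumr_ge0 => z _; rewrite mulr_ge0.
Qed.

Lemma le_coef_exp q q' k u : (forall j, 0 <= q`_j <= q'`_j) ->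
  (q ^+ k)`_u <= (q' ^+ k)`_u.
Proof.
move=> qq; elim: k u => [|k IH] u; first by rewrite !expr0.
rewrite !exprSr !coefM; apply: ler_sum => z _.
have q0 j : 0 <= q`_j by case/andP: (qq j).
by apply: ler_pM => //; [exact: coef_exp_ge0|case/andP: (qq (u - z)%N)].
Qed.

Lemma psum_coef_horner q n t : (size q <= n)%N ->
  q.[t] = \sum_(0 <= u < n) q`_u * t ^+ u.
Proof. by move=> qn; rewrite (horner_coef_wide _ qn) big_mkord. Qed.

(** Exponential Markov inequality, in the form [1 <= t ^ u / t ^ n] for
    [n <= u]. *)
Lemma chernoff_upper q n t : (forall j, 0 <= q`_j) -> 1 <= t ->
  q.[1] - q.[t] / t ^+ n <= \sum_(0 <= u < n) q`_u.
Proof.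
move=> q0 t1; have t0 : 0 < t by exact: lt_le_trans t1.
pose N := maxn (size q) n.
rewrite !(@psum_coef_horner q N) ?leq_maxl// mulr_suml -sumrB.
rewrite (@big_cat_nat _ _ _ n) ?leq_maxr//= -[leRHS]addr0.
apply: lerD; last first.
  rewrite big_nat; apply: sumr_le0 => u /andP[nu _].
  rewrite expr1n -mulrA -mulrBr mulr_ge0_le0// subr_le0.
  by rewrite ler_pdivlMr ?exprn_gt0// mul1r ler_weXn2l.
apply: ler_sum => u _; rewrite expr1n mulr1 lerBlDr lerDl.
by rewrite divr_ge0// ?mulr_ge0// exprn_ge0// ltW.
Qed.

(** Exponential Markov inequality for the lower tail: [t ^ n <= t ^ u] for
    [u <= n] and [t <= 1]. *)
Lemma chernoff_lower q n t : (forall j, 0 <= q`_j) -> 0 < t <= 1 ->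
  \sum_(0 <= u < n.+1) q`_u <= q.[t] / t ^+ n.
Proof.
move=> q0 /andP[t0 t1].
pose N := maxn (size q) n.+1.
rewrite !(@psum_coef_horner q N) ?leq_maxl//.
rewrite ler_pdivlMr ?exprn_gt0// mulr_suml.
rewrite [leRHS](@big_cat_nat _ _ _ n.+1) ?leq_maxr//= -[leLHS]addr0.
apply: lerD; last first.
  by apply: sumr_ge0 => u _; rewrite mulr_ge0// exprn_ge0// ltW.
apply: ler_sum_nat => u /andP[_ un].
by rewrite ler_wpM2l// ler_wiXn2l// ltW.
Qed.

Lemma bernoulli_le (v : R) k : 0 <= v <= 1 -> 1 - (1 - v) ^+ k <= k%:R * v.
Proof.
move=> /andP[v0 v1]; elim: k => [|k IH]; first by rewrite expr0 subrr mul0r .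
rewrite exprS -natr1.
have : 0 <= (1 - v) ^+ k <= 1 by rewrite exprn_ge0 ?exprn_ile1 // ; lra.
by move=> /andP[]; nra.
Qed.

(** A sum of [k] terms exceeds [x] either because one term exceeds [y], or
    because the sum of the terms truncated at [y] does, and the latter event is
    controlled by the exponential moment of the truncated law. The generating
    polynomial carries both: at [1] it gives the probability that no term
    exceeds [y], at [expR s] the exponential moment. *)
Lemma tl_convpow_le p k x y s : is_law p -> 0 <= y <= x -> 0 <= s ->
  tl (convpow p k) x <= k%:R * tl p y +
    expR (- (s * x)) *
      (\sum_(0 <= j < (Num.truncn y).+1) p j * expR (s * j%:R)) ^+ k.
Proof.
move=> pp /andP[y0 yx] s0; have [p0 _] := pp.
set n := (Num.truncn x).+1; set m := (Num.truncn y).+1.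
have mn : (m <= n)%N by rewrite ltnS le_truncn.
have g0 N j : 0 <= (genpoly p N)`_j by rewrite coef_poly; case: ifP.
have h1 : \sum_(0 <= u < n) (genpoly p m ^+ k)`_u <=
    \sum_(0 <= u < n) convpow p k u.
  apply: ler_sum_nat => u /andP[_ un].
  rewrite -(coef_genpoly p k un); apply: le_coef_exp => j.
  rewrite g0/= !coef_poly; case: ifP => jm; last by case: ifP.
  by rewrite ifT// (leq_trans jm).
have es1 : 1 <= expR s by rewrite -expR0 ler_expR.
have h2 := chernoff_upper n (fun j => coef_exp_ge0 k j (g0 m))
  es1.
rewrite !hornerE !horner_genpoly in h2.
have h3 := @bernoulli_le (tl p y) k.
rewrite tl_ge0// tl_le1// in h3; have {}h3 := h3 isT.
have e1 : \sum_(0 <= j < m) p j * 1 ^+ j = 1 - tl p y.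
  by rewrite /tl opprB addrCA subrr addr0; apply: eq_bigr => j _; rewrite expr1n mulr1.
have e2 : \sum_(0 <= j < m) p j * expR s ^+ j =
    \sum_(0 <= j < m) p j * expR (s * j%:R).
  by apply: eq_bigr => j _; rewrite mulr_natr -expRM_natr mulr_natr.
rewrite e1 e2 in h2; set M := (\sum_(0 <= j < m) _ * expR _) in h2 *.
have M0 : 0 <= M ^+ k.
  by rewrite exprn_ge0//; apply: sumr_ge0 => j _; rewrite mulr_ge0 ?expR_ge0.
(* [n] is the least integer above [x]. *)
have h4 : M ^+ k / expR s ^+ n <= expR (- (s * x)) * M ^+ k.
  rewrite mulrC ler_wpM2r// -expRM_natr -expRN ler_expR lerN2 ler_wpM2l//.
  by rewrite ltW// truncnS_gt.
rewrite {1}/tl -/n.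
lra.
Qed.

Lemma psum_exp_lower p k x s : is_law p -> 0 <= x -> 0 <= s ->
  1 - tl (convpow p k) x <= expR (s * x) *
      (\sum_(0 <= j < (Num.truncn x).+1) p j * expR (- (s * j%:R))) ^+ k.
Proof.
move=> pp x0 s0; have [p0 _] := pp.
set n := Num.truncn x.
have g0 N j : 0 <= (genpoly p N)`_j by rewrite coef_poly; case: ifP.
rewrite /tl opprB addrCA subrr addr0 -/n.
have -> : \sum_(0 <= u < n.+1) convpow p k u =
    \sum_(0 <= u < n.+1) (genpoly p n.+1 ^+ k)`_u.
  by apply: eq_big_nat => u /andP[_ un]; rewrite coef_genpoly.
have t1 : 0 < expR (- s) <= 1 by rewrite expR_gt0 expR_le1 oppr_le0.
apply: (le_trans (chernoff_lower n (fun j => coef_exp_ge0 k j (g0 _)) t1)).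
rewrite !hornerE !horner_genpoly.
have -> : \sum_(0 <= j < n.+1) p j * expR (- s) ^+ j =
    \sum_(0 <= j < n.+1) p j * expR (- (s * j%:R)).
  by apply: eq_bigr => j _; rewrite -expRM_natr mulNr.
rewrite mulrC ler_wpM2r//.
  by rewrite exprn_ge0//; apply: sumr_ge0 => j _; rewrite mulr_ge0 ?expR_ge0.
rewrite -expRM_natr -expRN ler_expR mulNr opprK ler_wpM2l//.
by rewrite truncn_le.
Qed.

End convolution_powers.

(** * Uniform large deviations for doubling tails *)

Section large_deviations.
Context {R : realType}.
Implicit Types (p : nat -> R) (m x y z e s d v : R).

Definition has_mean p m := series (fun j => j%:R * p j) @ \oo --> m.

Lemma has_mean_ge p m n : is_law p -> has_mean p m ->
  \sum_(0 <= j < n) j%:R * p j <= m.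
Proof. by move=> [p0 _]; apply: le_psum_lim => j; rewrite mulr_ge0. Qed.

(** [x * tl p x] is at most the part of the mean that lies beyond [x]. *)
Lemma mul_tl_near0 p m e : is_law p -> has_mean p m -> 0 < e ->
  \forall x \near +oo, x * tl p x <= e.
Proof.
move=> pp pm e0; have [p0 p1] := pp.
have e2 : 0 < e / 2 by rewrite divr_gt0.
have jp0 j : 0 <= j%:R * p j by rewrite mulr_ge0.
have near_m := near_truncn (R := R) (psum_near_lim jp0 pm e2).
near=> x.
have x0 : 0 < x by near: x; exact: nbhs_pinfty_gt.
have mx : m - e / 2 <= \sum_(0 <= j < (Num.truncn x).+1) j%:R * p j.
  by near: x; exact: near_m.
set n := (Num.truncn x).+1 in mx *.
have ex : 0 < e / 2 / x by rewrite divr_gt0.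
(* The mass beyond some [N] is too small to matter even when multiplied by [x]. *)
have [N _ NP] := psum_near_lim p0 p1 ex.
have := NP (maxn n N) (leq_maxr _ _); set N' := maxn n N => {NP}NP.
have nN : (n <= N')%N by exact: leq_maxl.
have jm := has_mean_ge N' pp pm.
rewrite (@big_cat_nat _ _ _ n)//= in jm.
rewrite (@big_cat_nat _ _ _ n)//= in NP.
set A := \sum_(n <= j < N') _ in jm; set B := \sum_(n <= j < N') _ in NP.
have AB : x * B <= A.
  rewrite mulr_sumr; apply: ler_sum_nat => j /andP[nj _].
  by rewrite ler_wpM2r// ltW// (lt_le_trans (truncnS_gt x))// ler_nat.
have : tl p x <= B + e / 2 / x by rewrite /tl -/n; lra.
move=> /(ler_wpM2l (ltW x0)); rewrite [x * (B + _)]mulrDr [x * (e / 2 / x)]mulrCA divff ?gt_eqF//.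
by rewrite mulr1; lra.
Unshelve. all: by end_near. Qed.

(** Dominated variation; the factor is a power of [2] so that iterating it
    bounds [tl p (y / l)] by a power of [l], see [doubling_le]. *)
Definition doubling p (r : nat) := forall z, 0 <= z -> tl p z <= 2 ^+ r * tl p (2 * z).

Lemma exp2_gt_nat z : exists r : nat, z <= 2 ^+ r.
Proof.
exists (Num.truncn z).+1; apply/ltW/(lt_le_trans (truncnS_gt z)).
by rewrite -natrX ler_nat ltnW// ltn_expl.
Qed.

Lemma regvar_doubling p beta : is_law p -> (forall x, 0 < tl p x) ->
  regvar (tl p) beta -> exists r, doubling p r.
Proof.
move=> pp tp0 rp.
have h2 : (0 : R) < 1 / 2 by rewrite divr_gt0.
have [M [_ MP]] := asymp_ge (rp 2 (ltr0Sn R 1)) h2.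
(* Below [N] the tail is at most [1]; above, regular variation applies. *)
pose N := Num.max M 0 + 1.
have NM : M < N by rewrite /N ltr_pwDr// le_max lexx.
have w0 : 0 < 2 `^ (- beta) :> R by exact: powR_gt0.
have [r rP] := exp2_gt_nat (Num.max (2 / 2 `^ (- beta)) (tl p (2 * N))^-1).
move: rP; rewrite ge_max => /andP[r1 r2]; exists r => z z0.
have [zN|Nz] := leP z N.
  apply: (le_trans (tl_le1 z pp)).
  apply: (@le_trans _ _ ((tl p (2 * N))^-1 * tl p (2 * z))).
    rewrite -[leLHS](@mulVf _ (tl p (2 * N))) ?gt_eqF//.
    by rewrite ler_wpM2l ?invr_ge0 ?tl_ge0// tl_nonincr// ler_wpM2l.
  by rewrite ler_wpM2r ?tl_ge0.
have := MP z (lt_trans NM Nz) => {}MP.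
have : tl p z <= 2 / 2 `^ (- beta) * tl p (2 * z).
  by rewrite mulrAC ler_pdivlMr//; lra.
by move=> /le_trans; apply; rewrite ler_wpM2r ?tl_ge0.
Qed.

Lemma doubling_iter p r n z : doubling p r -> 0 <= z ->
  tl p z <= (2 ^+ n) ^+ r * tl p (2 ^+ n * z).
Proof.
move=> dp z0; elim: n => [|n IH]; first by rewrite !expr1n !mul1r.
apply: (le_trans IH); rewrite exprSr exprMn -!mulrA ler_wpM2l ?exprn_ge0//.
have := dp (2 ^+ n * z); rewrite mulr_ge0// ?exprn_ge0// => /(_ isT).
by rewrite [2 * (_ * z)]mulrCA.
Qed.

Lemma doubling_le p r l y : is_law p -> doubling p r -> 0 <= y -> 1 <= l ->
  tl p (y / l) <= (2 * l) ^+ r * tl p y.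
Proof.
move=> pp dp y0 l1; have l0 : 0 < l by exact: lt_le_trans l1.
have [n ln nl] : exists2 n : nat, l <= 2 ^+ n & 2 ^+ n <= 2 * l.
  case: (ex_minnP (exp2_gt_nat l)) => n ln nmin; exists n => //.
  case: n ln nmin => [|n] ln nmin; first by rewrite expr0; lra.
  rewrite exprS ler_wpM2l// leNgt; apply/negP => /ltW/nmin.
  by rewrite ltnn.
have yl : 0 <= y / l by rewrite divr_ge0// ltW.
apply: (le_trans (doubling_iter n dp yl)).
apply: ler_pM; rewrite ?exprn_ge0 ?tl_ge0 ?lerXn2r ?nnegrE ?exprn_ge0//.
  by rewrite mulr_ge0// ltW.
by apply: tl_nonincr; rewrite // mulrCA ler_peMr// ler_pdivlMr// mul1r.
Qed.

Lemma expR_le1Dx (z : R) : expR z <= 1 + z * expR z.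
Proof.
have := expR_ge1Dx (- z); have := expR_gt0 z.
by rewrite expRN => e0; rewrite -(ler_pM2r e0) mulVf ?gt_eqF//; lra.
Qed.

Lemma exprn_le_expR (z : R) r : 0 <= z -> z ^+ r <= r`!%:R * expR z.
Proof.
move=> z0; case: r => [|r].
  by rewrite expr0 mul1r -expR0 ler_expR.
have := expR_ge1Dxn r z0 => h.
have f0 : 0 < r.+1`!%:R :> R by rewrite ltr0n fact_gt0.
by rewrite -ler_pdivrMl// mulrC; lra.
Qed.

(** Values up to [h] are estimated through [expR z <= 1 + z * expR z] and the
    mean, values between [h] and [y] by the crudest bound. *)
Lemma truncated_mgf_le p m s h y : is_law p -> has_mean p m -> 0 <= s ->
  0 <= h <= y ->
  \sum_(0 <= j < (Num.truncn y).+1) p j * expR (s * j%:R) <=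
    1 + s * expR (s * h) * m + expR (s * y) * tl p h.
Proof.
move=> pp pm s0 /andP[h0 hy]; have [p0 _] := pp.
have y0 : 0 <= y := le_trans h0 hy.
set n := (Num.truncn h).+1; set N := (Num.truncn y).+1.
have nN : (n <= N)%N by rewrite ltnS le_truncn.
rewrite (@big_cat_nat _ _ _ n)//=.
apply: lerD.
  apply: (@le_trans _ _ (\sum_(0 <= j < n) p j +
      s * expR (s * h) * \sum_(0 <= j < n) j%:R * p j)).
    rewrite mulr_sumr -big_split/=; apply: ler_sum_nat => j /andP[_ jn].
    have -> : p j + s * expR (s * h) * (j%:R * p j) =
        p j * (1 + s * j%:R * expR (s * h)) by ring.
    rewrite ler_wpM2l//.
    apply: (le_trans (expR_le1Dx _)); rewrite lerD2l.
    rewrite ler_wpM2l ?mulr_ge0// ler_expR ler_wpM2l//.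
    by rewrite -truncn_ge_nat.
  apply: lerD; first exact: psum_le1.
  by rewrite ler_wpM2l ?mulr_ge0 ?expR_ge0// has_mean_ge.
apply: (@le_trans _ _ (expR (s * y) * \sum_(n <= j < N) p j)).
  rewrite mulr_sumr; apply: ler_sum_nat => j /andP[_ jN].
  rewrite mulrC ler_wpM2r// ler_expR ler_wpM2l//.
  by rewrite -truncn_ge_nat.
rewrite ler_wpM2l ?expR_ge0//.
have := psum_le1 N pp; rewrite (@big_cat_nat _ _ _ n)//= /tl -/n; lra.
Qed.

(** With [L = - ln v], the truncation level [y], the exponent [s = L / (2 y)] and
    the cut [h = y d / L] make the exponential bound of [tl_convpow_le] at most
    a constant times [expR (- L) = v]. Indeed the values below [h] inflate the
    mean by a factor at most [1 + d], which the gap between [k m] and [x]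
    absorbs and still leaves [- s x d ^ 2 = - L]; and the values above [h]
    contribute [k * expR (L / 2) * tl p h], which by doubling is at most
    [expR (- L / 2)] times a power of [L], hence bounded. *)
Lemma large_deviation_core p m r d x k (y := d ^+ 2 / 2 * x) (v := k%:R * tl p y) :
  is_law p -> has_mean p m -> doubling p r -> 0 < d < 1 -> 0 < x ->
  k%:R * m <= (1 - d) * x -> 0 < v <= expR (- 1) ->
  tl (convpow p k) x <= (1 + expR (r`!%:R * (4 / d) ^+ r)) * v.
Proof.
move=> pp pm dp /andP[d0 d1] x0 km /andP[v0 v1].
pose L := - ln v.
have vL : v = expR (- L) by rewrite opprK lnK.
have L1 : 1 <= L by move: v1; rewrite vL ler_expR; lra.
have L0 : 0 < L by exact: lt_le_trans L1.
have dd : 0 < d ^+ 2 by rewrite exprn_gt0.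
have y0 : 0 < y by rewrite mulr_gt0// divr_gt0.
have yx : y <= x.
  by rewrite /y ler_piMl ?ltW// expr2; nra.
pose s := L / (2 * y); pose h := y / (L / d).
have s0 : 0 < s by rewrite divr_gt0// mulr_gt0.
have Ld1 : 1 <= L / d by rewrite ler_pdivlMr// mul1r; lra.
have Ld0 : 0 < L / d by exact: lt_le_trans Ld1.
have h0 : 0 < h by rewrite divr_gt0.
have hy : h <= y by rewrite /h ler_pdivrMr// ler_peMr// ltW.
have sy : s * y = L / 2 by rewrite /s; field; rewrite gt_eqF.
have sh : s * h = d / 2 by rewrite /s /h; field; rewrite !gt_eqF.
have sx : s * x * d ^+ 2 = L.
  by rewrite /s /y; field; rewrite !gt_eqF.
have eh : expR (s * h) <= 1 + d.
  have := expR_ge1Dx (- (s * h)); rewrite expRN sh => hh.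
  have e0 := expR_gt0 (d / 2).
  have : (1 - d / 2) * expR (d / 2) <= 1.
    by rewrite -[leRHS](@mulVf _ (expR (d / 2))) ?gt_eqF// ler_wpM2r// ltW.
  by nra.
pose C := r`!%:R * (4 / d) ^+ r.
(* [(L / 2) ^ r <= r! expR (L / 2)] absorbs the power of [L] due to doubling. *)
have kh : k%:R * (expR (s * y) * tl p h) <= C.
  have th : tl p h <= (2 * (L / d)) ^+ r * tl p y.
    by apply: doubling_le => //; exact: ltW.
  apply: (@le_trans _ _ (expR (s * y) * (2 * (L / d)) ^+ r * v)).
    rewrite /v [leRHS]mulrCA -[X in _ <= _ * X]mulrA.
    by rewrite ler_wpM2l// ler_wpM2l ?expR_ge0//.
  have -> : 2 * (L / d) = L / 2 * (4 / d) by field; rewrite gt_eqF.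
  rewrite exprMn sy vL.
  have := @exprn_le_expR (L / 2) r; rewrite divr_ge0 ?(ltW L0)// => /(_ isT) hL.
  rewrite mulrAC mulrA -expRD.
  have -> : L / 2 + - L = - (L / 2) by field.
  rewrite /C ler_wpM2r ?exprn_ge0 ?divr_ge0 ?(ltW d0)//.
  by rewrite expRN mulrC ler_pdivrMr ?expR_gt0.
have yx' : 0 <= y <= x by rewrite ltW.
apply: (le_trans (tl_convpow_le k pp yx' (ltW s0))).
rewrite mulrDl mul1r lerD2l.
have hy' : 0 <= h <= y by rewrite ltW.
have := truncated_mgf_le pp pm (ltW s0) hy'.
set M := \sum_(0 <= j < _) _ => MP.
have M0 : 0 <= M.
  by apply: sumr_ge0 => j _; rewrite mulr_ge0 ?expR_ge0//; case: pp.
have {}MP : M <= expR (s * expR (s * h) * m + expR (s * y) * tl p h).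
  by apply: le_trans (expR_ge1Dx _); rewrite addrA.
have Mk : M ^+ k <=
    expR (k%:R * (s * expR (s * h) * m + expR (s * y) * tl p h)).
  by rewrite expRM_natl lerXn2r// nnegrE expR_ge0.
apply: (@le_trans _ _ (expR (- (s * x)) *
    expR (k%:R * (s * expR (s * h) * m + expR (s * y) * tl p h)))).
  by rewrite ler_wpM2l// expR_ge0.
rewrite [X in _ <= _ * X]vL -!expRD ler_expR -/C mulrDr.
(* [(1 + d) (1 - d) = 1 - d ^ 2]: inflated mean against the gap. *)
have km' : k%:R * (s * expR (s * h) * m) <= s * (1 - d ^+ 2) * x.
  have -> : k%:R * (s * expR (s * h) * m) = s * (expR (s * h) * (k%:R * m)).
    by ring.
  rewrite -mulrA ler_wpM2l ?(ltW s0)//.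
  have -> : (1 - d ^+ 2) * x = (1 + d) * ((1 - d) * x) by ring.
  apply: (@le_trans _ _ (expR (s * h) * ((1 - d) * x))).
    by rewrite ler_wpM2l ?expR_ge0.
  by rewrite ler_wpM2r// mulr_ge0 ?(ltW x0)//; lra.
move: kh km' sx; lra.
Qed.

(** A finite mean makes [x * tl p x] small, so that the hypothesis
    [v <= expR (- 1)] of [large_deviation_core] holds uniformly over all
    [k <= x / m]. *)
Lemma large_deviation p m r d : is_law p -> (forall x, 0 < tl p x) ->
  doubling p r -> has_mean p m -> 0 < m -> 0 < d < 1 ->
  exists2 C, 0 < C & \forall x \near +oo, forall k,
    k%:R * m <= (1 - d) * x -> tl (convpow p k) x <= C * k%:R * tl p x.
Proof.
move=> pp tp0 dp pm m0 dP; have /andP[d0 d1] := dP.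
pose th := d ^+ 2 / 2.
have th0 : 0 < th by rewrite divr_gt0// exprn_gt0.
have th1 : th <= 1 by rewrite /th expr2; nra.
exists ((1 + expR (r`!%:R * (4 / d) ^+ r)) * (2 / th) ^+ r).
  apply: mulr_gt0; last exact: exprn_gt0 (divr_gt0 (ltr0Sn R 1) th0).
  by rewrite ltr_pwDl ?expR_ge0.
have e0 : 0 < expR (- 1) * m * th by rewrite !mulr_gt0 ?expR_gt0.
have sm := near_pinftyM th0 (mul_tl_near0 pp pm e0).
near=> x => k km.
have x0 : 0 < x by near: x; exact: nbhs_pinfty_gt.
have [->|k0] := posnP k; first by rewrite tl_convpow0 mulr0 mul0r.
have kv : 0 < k%:R * tl p (th * x) <= expR (- 1).
  rewrite mulr_gt0 ?ltr0n//=.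
  have /= hx : th * x * tl p (th * x) <= expR (- 1) * m * th by near: x.
  have kx : k%:R * m <= x by apply: (le_trans km); rewrite ler_piMl ?ltW//; lra.
  have {}hx : x * tl p (th * x) <= expR (- 1) * m.
    by rewrite -(ler_pM2r th0); apply: le_trans hx; rewrite mulrAC [x * th]mulrC.
  rewrite -(ler_pM2r m0); apply: le_trans hx.
  by rewrite mulrAC ler_wpM2r// ltW.
apply: (le_trans (large_deviation_core pp pm dp dP x0 km kv)).
have ht : tl p (th * x) <= (2 / th) ^+ r * tl p x.
  have it : 1 <= th^-1 by rewrite invf_ge1.
  by have := doubling_le pp dp (ltW x0) it; rewrite invrK [x * th]mulrC.
rewrite -[leRHS]mulrA -[leRHS]mulrA; apply: ler_wpM2l.
  by rewrite addr_ge0// expR_ge0.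
by rewrite [leRHS]mulrCA ler_wpM2l.
Unshelve. all: by end_near. Qed.

End large_deviations.

(** * Tails of random sums *)

Section random_sums.
Context {R : realType}.
Implicit Types (p pN r : nat -> R) (m x y z e s d v : R).

Lemma expRN_le_quadratic (z : R) : 0 <= z -> expR (- z) <= 1 - z + z ^+ 2.
Proof.
move=> z0; have := expR_ge1Dx z => h; have e0 := expR_gt0 z.
rewrite expRN -[leLHS]mul1r ler_pdivrMr//.
have : 0 <= 1 - z + z ^+ 2 by rewrite expr2; nra.
have : 0 <= z ^+ 3 by rewrite exprn_ge0.
rewrite exprS expr2; nra.
Qed.

Lemma truncated_laplace_le p s x (L : nat) : is_law p -> 0 <= s ->
  L%:R <= x ->
  \sum_(0 <= j < (Num.truncn x).+1) p j * expR (- (s * j%:R)) <=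
    1 - s * (\sum_(0 <= j < L) j%:R * p j) + (s * L%:R) ^+ 2.
Proof.
move=> pp s0 Lx; have [p0 _] := pp.
set n := (Num.truncn x).+1.
have x0 : 0 <= x by rewrite (le_trans _ Lx).
have Ln : (L <= n)%N by rewrite leqW// truncn_ge_nat.
apply: (@le_trans _ _ (\sum_(0 <= j < n) p j
    - s * (\sum_(0 <= j < L) j%:R * p j)
    + (s * L%:R) ^+ 2 * \sum_(0 <= j < L) p j)); last first.
  apply: lerD; first by rewrite lerD2r psum_le1.
  by rewrite ler_piMr ?sqr_ge0 ?psum_le1.
have tl_part : \sum_(L <= j < n) p j * expR (- (s * j%:R)) <= \sum_(L <= j < n) p j.
  apply: ler_sum => j _.
  by rewrite ler_piMr// expR_le1 oppr_le0 mulr_ge0.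
have hd_part : \sum_(0 <= j < L) p j * expR (- (s * j%:R)) <=
    \sum_(0 <= j < L) (p j - s * (j%:R * p j) + (s * L%:R) ^+ 2 * p j).
  apply: ler_sum_nat => j /andP[_ jL].
  have -> : p j - s * (j%:R * p j) + (s * L%:R) ^+ 2 * p j =
    p j * (1 - s * j%:R + (s * L%:R) ^+ 2) by ring.
  rewrite ler_wpM2l//; apply: (le_trans (expRN_le_quadratic _)).
    by rewrite mulr_ge0.
  rewrite lerD2l lerXn2r// ?nnegrE ?mulr_ge0// ler_wpM2l//.
  by rewrite ler_nat ltnW.
rewrite big_split sumrB/= -!mulr_sumr in hd_part.
rewrite (@big_cat_nat _ _ _ L 0 n)//= (@big_cat_nat _ _ _ L 0 n _ p)//=; lra.
Qed.

(** Exponential Markov inequality for the lower tail: the Laplace exponent of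
    the law at a small [s] is close to [s * m], which beats [s * x] when
    [k * m >= (1 + d) * x]. *)
Lemma law_of_large_numbers p m d eta : is_law p -> has_mean p m ->
  0 < m -> 0 < d -> 0 < eta -> \forall x \near +oo, forall k,
    (1 + d) * x <= k%:R * m -> 1 - eta <= tl (convpow p k) x.
Proof.
move=> pp pm m0 d0 eta0; have [p0 _] := pp.
have jp0 j : 0 <= j%:R * p j by rewrite mulr_ge0.
(* [c] is chosen so that [(1 + d) (1 - 2 c) = 1 + d / 2]. *)
pose c := d / (4 * (1 + d)).
have d1 : 0 < 1 + d by rewrite addr_gt0.
have c0 : 0 < c by rewrite divr_gt0// mulr_gt0.
have [L0 _ /(_ L0.+1 (leqnSn _)) /=] := psum_near_lim jp0 pm (mulr_gt0 c0 m0).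
set L := L0.+1 => Lm.
have Lp : 0 < L%:R :> R by rewrite ltr0n.
pose s := c * m / L%:R ^+ 2.
have s0 : 0 < s by apply: divr_gt0; [exact: mulr_gt0|exact: exprn_gt0].
have sL : (s * L%:R) ^+ 2 = s * (c * m) by rewrite /s; field; rewrite gt_eqF.
have sd0 : 0 < s * (d / 2) by rewrite mulr_gt0// divr_gt0.
near=> x => k km.
have x0 : 0 <= x by near: x; apply: nbhs_pinfty_ge; exact: num_real.
have Lx : L%:R <= x by near: x; apply: nbhs_pinfty_ge; exact: num_real.
have lnx : - ln eta / (s * (d / 2)) <= x by near: x; apply: nbhs_pinfty_ge; exact: num_real.
have := psum_exp_lower k pp x0 (ltW s0).
have := truncated_laplace_le pp (ltW s0) Lx.
set M := (\sum_(0 <= j < _.+1) _) => Mle Mge.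
have M0 : 0 <= M by apply: sumr_ge0 => j _; rewrite mulr_ge0 ?expR_ge0.
have {}Mle : M <= expR (- (s * m * (1 - 2 * c))).
  apply: le_trans (expR_ge1Dx _); apply: (le_trans Mle); rewrite sL.
  have := ler_wpM2l (ltW s0) Lm; lra.
have {}Mle : M ^+ k <= expR (k%:R * - (s * m * (1 - 2 * c))).
  by rewrite expRM_natl lerXn2r// nnegrE expR_ge0.
have : 1 - tl (convpow p k) x <= eta.
  apply: (le_trans Mge); apply: (@le_trans _ _ (expR (s * x) *
    expR (k%:R * - (s * m * (1 - 2 * c))))).
    by rewrite ler_wpM2l ?expR_ge0.
  rewrite -expRD -[leRHS]lnK ?posrE// ler_expR.
  move: lnx; rewrite ler_pdivrMr// => lnx.
  have cd : (1 + d) * (1 - 2 * c) = 1 + d / 2.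
    by rewrite /c; field; rewrite gt_eqF.
  have c1 : 0 <= 1 - 2 * c.
    by rewrite -(@pmulr_rge0 _ (1 + d))// cd; lra.
  have h : s * (1 - 2 * c) * ((1 + d) * x) <= s * (1 - 2 * c) * (k%:R * m).
    by rewrite ler_wpM2l// mulr_ge0// ltW.
  have h2 : s * (1 - 2 * c) * ((1 + d) * x) = s * x * (1 + d / 2).
    by rewrite -cd; ring.
  rewrite h2 in h; lra.
lra.
Unshelve. all: by end_near. Qed.

(** [r] is the law of a sum of [N] independent terms of law [p], where [N] is
    independent of the terms and has law [pN]. *)
Definition mixture pN p r :=
  forall u, series (fun a => pN a * convpow p a u) @ \oo --> r u.

(** Both sides are the probability that either [N >= A], or [N < A] and the
    random sum exceeds [x]. *)
Lemma mixture_psum pN p x A : is_law pN ->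
  (1 - \sum_(0 <= a < A) pN a)
    + \sum_(0 <= a < A) pN a * tl (convpow p a) x =
  1 - \sum_(0 <= u < (Num.truncn x).+1) \sum_(0 <= a < A) pN a * convpow p a u.
Proof.
move=> pNl; rewrite exchange_big/= -addrA; congr (_ + _).
rewrite addrC -sumrB -sumrN; apply: eq_bigr => a _.
by rewrite -mulr_sumr /tl; ring.
Qed.

(** When [N >= A] nothing is asked of the random sum. *)
Lemma tl_mixture_le pN p r x A : is_law pN -> is_law p -> mixture pN p r ->
  tl r x <= (1 - \sum_(0 <= a < A) pN a)
    + \sum_(0 <= a < A) pN a * tl (convpow p a) x.
Proof.
move=> pNl pl mr; rewrite mixture_psum// /tl lerD2l lerN2.
apply: ler_sum => u _; apply: le_psum_lim (mr u) => a.
by rewrite mulr_ge0//; [case: pNl|case: (law_convpow a pl)].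
Qed.

Lemma tl_mixture_ge pN p r x c K A : is_law pN -> is_law p -> mixture pN p r ->
  0 <= c <= 1 -> (K <= A)%N ->
  (forall a, (A <= a)%N -> c <= tl (convpow p a) x) ->
  \sum_(0 <= a < K) pN a * tl (convpow p a) x
    + c * (1 - \sum_(0 <= a < A) pN a) <= tl r x.
Proof.
move=> pNl pl mr /andP[c0 c1] KA cA; have [pN0 _] := pNl.
have t0 a : 0 <= pN a * tl (convpow p a) x.
  by rewrite mulr_ge0// tl_ge0//; exact: law_convpow.
set B := leLHS; rewrite /tl lerBrDr addrC -lerBrDr.
set n := (Num.truncn x).+1.
have cv : (fun B => \sum_(0 <= u < n) \sum_(0 <= a < B) pN a * convpow p a u)
    @ \oo --> \sum_(0 <= u < n) r u.
  by apply: cvg_sum_seq => u; exact: mr.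
rewrite -(cvg_lim _ cv)//; apply: limr_le; first by apply/cvg_ex; eexists; exact: cv.
exists A => // M /= AM.
rewrite -/n -[leLHS]opprK lerNl -(lerD2l 1) -mixture_psum// opprB addrCA subrr addr0.
have e1 : \sum_(0 <= a < M) pN a =
    \sum_(0 <= a < A) pN a + \sum_(A <= a < M) pN a.
  by rewrite -big_cat_nat.
have h1 : \sum_(0 <= a < K) pN a * tl (convpow p a) x +
    c * \sum_(A <= a < M) pN a <= \sum_(0 <= a < M) pN a * tl (convpow p a) x.
  rewrite [leRHS](@big_cat_nat _ _ _ A)//= lerD//; first exact: le_psum.
  rewrite mulr_sumr; apply: ler_sum_nat => a /andP[Aa _].
  by rewrite mulrC ler_wpM2l// cA.
have h2 := psum_le1 M pNl.
rewrite /B; move: h1; rewrite e1 in h2 *; nra.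
Qed.

Lemma asymp_sum_tl_convpow pN p beta K : is_law pN -> is_law p ->
  regvar (tl p) beta ->
  asymp (fun x => \sum_(0 <= a < K) pN a * tl (convpow p a) x)
    (fun x => (\sum_(0 <= a < K) a%:R * pN a) * tl p x).
Proof.
move=> [pN0 _] pl rp; elim: K => [|K IH].
  apply: (@asymp_eql _ (fun=> 0)) => [x|]; first by rewrite big_nil.
  apply: (@asymp_eqr _ _ (fun=> 0)) => [x|]; first by rewrite big_nil mul0r.
  by apply: asymp_refl; near=> x.
have := asympD IH (asympZ (pN0 K) (asymp_tl_convpow K pl rp)).
move=> h; apply: asymp_eql; last apply: asymp_eqr; last exact: h.
  by move=> x; rewrite /= big_nat_recr.
by move=> x; rewrite /= big_nat_recr//=; ring.
Unshelve. all: by end_near. Qed.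

Lemma has_mean_gt0 p m : is_law p -> (forall x, 0 < tl p x) -> has_mean p m ->
  0 < m.
Proof.
move=> pl tp0 pm; have [p0 p1] := pl.
have e0 : 0 < tl p 0 / 2 by rewrite divr_gt0.
have [N _ /(_ N.+1 (leqnSn _)) /=] := psum_near_lim p0 p1 e0.
have := tp0 0; rewrite /tl truncn0 big_nat1.
have := has_mean_ge N.+1 pl pm.
rewrite !big_nat_recl//= mul0r add0r => h1 h2 h3.
have : \sum_(0 <= i < N) p i.+1 <= \sum_(0 <= i < N) i.+1%:R * p i.+1.
  by apply: ler_sum => i _; rewrite ler_peMl// ler1n.
lra.
Qed.

(** Split according to [N]. For [N < K] a single large summand is responsible,
    which gives [E(N; N < K) * tl p x]. For [N] beyond [(1 -+ d) x / m] the law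
    of large numbers makes the event as likely as [N > x / m], up to a factor
    that tends to [1] with [d]. In between, [large_deviation] bounds the
    contribution by [C * E(N; N >= K) * tl p x]; as [C] depends on [d] only, it
    is negligible once [K] is large. *)
Lemma asymp_tl_random_sum pN p r beta m mu :
  is_law pN -> is_law p -> mixture pN p r ->
  (forall x, 0 < tl pN x) -> (forall x, 0 < tl p x) ->
  regvar (tl pN) beta -> regvar (tl p) beta ->
  has_mean p m -> has_mean pN mu ->
  asymp (tl r) (fun x => mu * tl p x + m `^ beta * tl pN x).
Proof.
move=> pNl pl mr tN0 tp0 rN rp pm pNm.
have [pN0 _] := pNl.
have m0 := has_mean_gt0 pl tp0 pm.
have mu0 := has_mean_gt0 pNl tN0 pNm.
have apN0 a : 0 <= a%:R * pN a by rewrite mulr_ge0.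
have mb0 : 0 <= m `^ beta by exact: powR_ge0.
have tNN : asymp (tl pN) (tl pN) by apply: asymp_refl; near=> x; exact: ltW.
(* The factor [m `^ beta] is [(1 / m) `^ (- beta)]. *)
have tNm q : 0 < q -> asymp (fun x => tl pN (q / m * x))
    (fun x => q `^ (- beta) * (m `^ beta * tl pN x)).
  move=> q0; apply: asymp_eqr (rN _ (divr_gt0 q0 m0)) => x.
  rewrite powRM ?invr_ge0 ?ltW// -[m^-1]powR_inv1 ?ltW// -powRrM.
  by rewrite mulrNN mul1r mulrA.
apply: asymp_sandwich => [e e0 e1|e e0 e1|]; last 1 first.
- by near=> x; rewrite addr_ge0// mulr_ge0// ltW.
- have e4 : 0 < e / 4 by rewrite divr_gt0.
  have [d /andP[d0 d2] [dl _]] := powR_near1 beta e4.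
  have dP : 0 < d < 1 by rewrite d0/=; lra.
  have d1 : 0 < 1 - d by lra.
  have [j dp] := regvar_doubling pl tp0 rp.
  have [C C0 CP] := large_deviation pl tp0 dp pm m0 dP.
  have muC : 0 < e / 4 * mu / C by rewrite divr_gt0// mulr_gt0.
  have [K _ /(_ K (leqnn _)) /= KP] := psum_near_lim apN0 pNm muC.
  near=> x.
  have x0 : 0 <= x by near: x; apply: nbhs_pinfty_ge; exact: num_real.
  have tpx := tp0 x; have tNx := tN0 x.
  have CPx : forall k, k%:R * m <= (1 - d) * x ->
    tl (convpow p k) x <= C * k%:R * tl p x by near: x.
  have q0 : 0 <= (1 - d) / m * x.
    by rewrite mulr_ge0// divr_ge0// ltW.
  (* [a < A] means [a m <= (1 - d) x], the range of [large_deviation]. *)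
  pose A := (Num.truncn ((1 - d) / m * x)).+1.
  have KA : (K <= A)%N.
    have : K%:R * m / (1 - d) <= x by near: x; apply: nbhs_pinfty_ge; exact: num_real.
    move=> hK; rewrite leqW// truncn_ge_nat//.
    by rewrite mulrAC ler_pdivlMr// [leRHS]mulrC -ler_pdivrMr.
  apply: (le_trans (tl_mixture_le x A pNl pl mr)).
  have h1 : 1 - \sum_(0 <= a < A) pN a <= (1 + 3 * (e / 4)) * (m `^ beta * tl pN x).
    apply: (@le_trans _ _ ((1 + e / 4) *
        ((1 - d) `^ (- beta) * (m `^ beta * tl pN x)))).
      by rewrite -/(tl pN ((1 - d) / m * x)); near: x; exact: asymp_le (tNm _ d1) e4.
    rewrite mulrA ler_wpM2r ?mulr_ge0 ?(ltW tNx)//.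
    by apply: (@le_trans _ _ ((1 + e / 4) * (1 + e / 4))); nra.
  have h2 : \sum_(0 <= a < K) pN a * tl (convpow p a) x <=
      (1 + e / 4) * (mu * tl p x).
    apply: (@le_trans _ _ ((1 + e / 4) *
        ((\sum_(0 <= a < K) a%:R * pN a) * tl p x))).
      by near: x; exact: asymp_le (asymp_sum_tl_convpow K pNl pl rp) e4.
    rewrite ler_wpM2l//; first by lra.
    by rewrite ler_wpM2r ?(ltW tpx)// has_mean_ge.
  have h3 : \sum_(K <= a < A) pN a * tl (convpow p a) x <= e / 4 * (mu * tl p x).
    apply: (@le_trans _ _ (C * tl p x * \sum_(K <= a < A) a%:R * pN a)).
      rewrite mulr_sumr; apply: ler_sum_nat => a /andP[_ aA].
      have -> : C * tl p x * (a%:R * pN a) = pN a * (C * a%:R * tl p x) by ring.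
      rewrite ler_wpM2l// CPx// -ler_pdivlMr// mulrAC.
      by rewrite -truncn_ge_nat.
    have := has_mean_ge A pNl pNm; rewrite (@big_cat_nat _ _ _ K)//= => hA.
    have {}hA : \sum_(K <= a < A) a%:R * pN a <= e / 4 * mu / C by lra.
    apply: (@le_trans _ _ (C * tl p x * (e / 4 * mu / C))).
      by rewrite ler_wpM2l// mulr_ge0// ltW.
    by rewrite le_eqVlt; apply/orP; left; apply/eqP; field; rewrite gt_eqF.
  rewrite [X in _ + X <= _](@big_cat_nat _ _ _ K)//=.
  have F0 := mulr_gt0 mu0 tpx.
  have G0 : 0 <= m `^ beta * tl pN x by rewrite mulr_ge0// ltW.
  set F := mu * tl p x in h2 h3 F0 *; set G := m `^ beta * tl pN x in h1 G0 *.
  have eF : 0 <= e * F by rewrite mulr_ge0// ltW.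
  have eG : 0 <= e * G by rewrite mulr_ge0// ltW.
  lra.
- have e4 : 0 < e / 4 by rewrite divr_gt0.
  have [d /andP[d0 d2] [_ dl]] := powR_near1 beta e4.
  have d1 : 0 < 1 + d by lra.
  have mue : 0 < e / 4 * mu by rewrite mulr_gt0.
  have [K _ /(_ K (leqnn _)) /= KP] := psum_near_lim apN0 pNm mue.
  have LLN := law_of_large_numbers pl pm m0 d0 e4.
  near=> x.
  have x0 : 0 <= x by near: x; apply: nbhs_pinfty_ge; exact: num_real.
  have tpx := tp0 x; have tNx := tN0 x.
  have LLNx : forall k, (1 + d) * x <= k%:R * m ->
    1 - e / 4 <= tl (convpow p k) x by near: x.
  have q0 : 0 <= (1 + d) / m * x.
    by rewrite mulr_ge0// divr_ge0// ltW.
  (* [a >= A] implies [a m >= (1 + d) x], the range of [law_of_large_numbers]. *)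
  pose A := (Num.truncn ((1 + d) / m * x)).+1.
  have KA : (K <= A)%N.
    have : K%:R * m / (1 + d) <= x by near: x; apply: nbhs_pinfty_ge; exact: num_real.
    move=> hK; rewrite leqW// truncn_ge_nat//.
    by rewrite mulrAC ler_pdivlMr// [leRHS]mulrC -ler_pdivrMr.
  have c01 : 0 <= 1 - e / 4 <= 1 by apply/andP; split; lra.
  have Aa a : (A <= a)%N -> 1 - e / 4 <= tl (convpow p a) x.
    move=> Aa; apply: LLNx; rewrite -ler_pdivrMr// mulrAC.
    by rewrite ltW// (lt_le_trans (truncnS_gt _))// ler_nat.
  apply: le_trans (tl_mixture_ge pNl pl mr c01 KA Aa).
  have h1 : (1 - e / 4) ^+ 2 * (m `^ beta * tl pN x) <= 1 - \sum_(0 <= a < A) pN a.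
    apply: (@le_trans _ _ ((1 - e / 4) *
        ((1 + d) `^ (- beta) * (m `^ beta * tl pN x)))).
      rewrite expr2 -mulrA ler_wpM2l//; first by lra.
      by rewrite ler_wpM2r// mulr_ge0// ltW.
    by rewrite -/(tl pN ((1 + d) / m * x)); near: x; exact: asymp_ge (tNm _ d1) e4.
  have h2 : (1 - e / 4) ^+ 2 * (mu * tl p x) <=
      \sum_(0 <= a < K) pN a * tl (convpow p a) x.
    apply: (@le_trans _ _ ((1 - e / 4) *
        ((\sum_(0 <= a < K) a%:R * pN a) * tl p x))).
      rewrite expr2 -mulrA ler_wpM2l//; first by lra.
      by rewrite mulrA ler_wpM2r ?(ltW tpx)//; lra.
    by near: x; exact: asymp_ge (asymp_sum_tl_convpow K pNl pl rp) e4.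
  have M0 := mulr_gt0 mu0 tpx.
  have N0 : 0 <= m `^ beta * tl pN x by rewrite mulr_ge0// ltW.
  set F := mu * tl p x in h2 M0 *; set G := m `^ beta * tl pN x in h1 N0 *.
  have h4 : (1 - e) * G <= (1 - e / 4) * ((1 - e / 4) ^+ 2 * G).
    by rewrite mulrA ler_wpM2r// expr2; nra.
  have h5 : (1 - e) * F <= (1 - e / 4) ^+ 2 * F.
    by rewrite ler_wpM2r// ?(ltW M0)// expr2; nra.
  rewrite mulrDr; apply: lerD; first exact: le_trans h2.
  apply: (le_trans h4); rewrite ler_wpM2l//; lra.
Unshelve. all: by end_near. Qed.

End random_sums.

(** * Events independent of part of an independent family *)

Section probabilities.
Context {d : measure_display} {T : measurableType d} {R : realType}
  (P : probability T R).
Implicit Types (E F : set T).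

Definition pr E : R := fine (P E).

Lemma prE E : measurable E -> P E = (pr E)%:E.
Proof. by move=> mE; rewrite fineK// fin_num_measure. Qed.

Lemma pr_ge0 E : 0 <= pr E.
Proof. exact: fine_ge0. Qed.

Lemma pr_bigcup (F : nat -> set T) : (forall i, measurable (F i)) ->
  trivIset setT F -> series (fun i => pr (F i)) @ \oo --> pr (\bigcup_i F i).
Proof.
move=> mF tF; have mU : measurable (\bigcup_i F i) by exact: bigcup_measurable.
have -> : series (fun i => pr (F i)) = fine \o (fun n => \sum_(0 <= i < n) P (F i))%E.
  apply/funext => n /=; under [in RHS]eq_bigr do rewrite prE//.
  by rewrite sumEFin.
by apply: fine_cvg; rewrite -prE//; exact: measure_semi_sigma_additive.
Qed.

End probabilities.

Section independence.
Context {d : measure_display} {T : measurableType d} {R : realType}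
  {P : probability T R} {I : choiceType} {d' : measure_display}
  {T' : measurableType d'} (Y : I -> {RV P >-> T'}).
Implicit Types (E : set T) (D : set I).
Local Notation pr := (pr P).

(** [E] is independent of the variables [Y i] with [i] outside [D]. For a
    mutually independent family this holds for every event that depends on the
    variables indexed by [D] only; having it as a closure property avoids
    generated sigma-algebras. *)
Definition indep_off D E := measurable E /\
  forall (J : {fset I}) (A : I -> set T'), (forall i, measurable (A i)) ->
    (forall i, i \in J -> ~ D i) ->
    pr (E `&` \bigcap_(i in [set` J]) (Y i @^-1` A i)) =
    pr E * \prod_(i <- J) pr (Y i @^-1` A i).

Lemma measurable_RV_preimage i B : measurable B -> measurable (Y i @^-1` B).
Proof. by move=> mB; rewrite -[X in measurable X]setTI; exact: measurable_funP. Qed.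

Lemma indep_off_setT D : mutually_independent Y -> indep_off D setT.
Proof.
move=> iY; split=> // J A mA _; rewrite setTI.
have -> : pr setT = 1 by rewrite -[pr _]/(fine (P setT)) probability_setT.
rewrite mul1r -[LHS]/(fine (P _)) iY//.
rewrite (eq_bigr (fun i => (pr (Y i @^-1` A i))%:E)) => [|i _]; last first.
  exact: prE (measurable_RV_preimage i (mA i)).
by rewrite prodEFin.
Qed.

Lemma indep_off_sub D D' E : D `<=` D' -> indep_off D E -> indep_off D' E.
Proof.
move=> DD [mE iE]; split=> // J A mA JD; apply: iE => // i iJ Di.
exact: (JD i iJ (DD i Di)).
Qed.

Lemma indep_off_setI D E i B : indep_off D E -> ~ D i -> measurable B ->
  indep_off (D `|` [set i]) (E `&` Y i @^-1` B) /\
  pr (E `&` Y i @^-1` B) = pr E * pr (Y i @^-1` B).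
Proof.
move=> [mE iE] Di mB.
have prEB : pr (E `&` Y i @^-1` B) = pr E * pr (Y i @^-1` B).
  have := iE [fset i]%fset (fun=> B) (fun=> mB).
  rewrite big_seq_fset1 => <-.
    congr (pr (_ `&` _)); apply/seteqP; split=> [w Yw j /=|w /(_ i)/=].
      by rewrite inE => /eqP ->.
    by apply; rewrite inE.
  by move=> j; rewrite inE => /eqP ->.
split=> //; split; first by apply: measurableI => //; exact: measurable_RV_preimage.
move=> J A mA JD.
have iJ : i \notin J by apply/negP => /JD; apply; right.
(* Apply the hypothesis to the family [J] enlarged by [i]. *)
pose A' j := if j == i then B else A j.
have mA' j : measurable (A' j) by rewrite /A'; case: ifP.
have AA' j : j \in J -> A' j = A j.
  by rewrite /A'; case: eqP => // ->; rewrite (negbTE iJ).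
have A'i : A' i = B by rewrite /A' eqxx.
have := iE (i |` J)%fset A' mA'.
rewrite big_fsetU1//= A'i mulrA -prEB => H.
rewrite [RHS](_ : _ = pr (E `&` Y i @^-1` B) * \prod_(j <- J) pr (Y j @^-1` A' j)); last first.
  congr (_ * _); rewrite big_seq [RHS]big_seq.
  by apply: eq_bigr => j jJ; rewrite AA'.
rewrite -H; last first.
  move=> j; rewrite !inE => /orP[/eqP -> //|jJ] Dj.
  by apply: (JD j jJ); left.
congr pr; apply/seteqP; split=> [w [[Ew Bw] Jw]|w [Ew Jw]].
  split=> // j /=; rewrite !inE => /orP[/eqP ->|jJ].
    by rewrite /A' eqxx.
  by rewrite AA'//; exact: Jw.
split; first split=> //.
  by have := Jw i; rewrite /= !inE eqxx /A' eqxx; apply.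
move=> j /= jJ; have := Jw j; rewrite /= !inE jJ orbT AA'//; exact.
Qed.

Lemma indep_off_bigcup D (F : nat -> set T) : (forall i, indep_off D (F i)) ->
  trivIset setT F -> indep_off D (\bigcup_i F i).
Proof.
move=> iF tF; have mF i : measurable (F i) by case: (iF i).
split; first exact: bigcup_measurable.
move=> J A mA JD.
set G := \bigcap_(i in _) _; set c := \prod_(i <- J) _.
have mG : measurable G.
  rewrite /G bigcap_fset big_seq.
  by apply: bigsetI_measurable => i _; exact: measurable_RV_preimage.
have h1 : series (fun i => pr (F i `&` G)) @ \oo --> pr (\bigcup_i F i `&` G).
  rewrite setI_bigcupl; apply: pr_bigcup; last exact: trivIset_setIr.
  by move=> i; exact: measurableI.
have h2 : series (fun i => pr (F i `&` G)) @ \oo --> pr (\bigcup_i F i) * c.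
  have -> : series (fun i => pr (F i `&` G)) = (fun n => series (fun i => pr (F i)) n * c).
    apply/funext => n; rewrite /series/= mulr_suml; apply: eq_bigr => i _.
    by case: (iF i) => _; apply.
  by apply: cvgMl; exact: pr_bigcup.
by rewrite -(cvg_lim _ h1)// -(cvg_lim _ h2).
Qed.

End independence.

(** * Laws of integer random variables *)

Section laws.
Context {d : measure_display} {T : measurableType d} {R : realType}
  (P : probability T R).

Definition law (Y : T -> nat) j : R := pr P (Y @^-1` [set j]).

Lemma bigcup_preimage1 (Y : T -> nat) : \bigcup_j (Y @^-1` [set j]) = setT.
Proof. by apply/seteqP; split=> // w _; exists (Y w). Qed.

Lemma is_law_law (Y : T -> nat) : (forall j, measurable (Y @^-1` [set j])) ->
  is_law (law Y).
Proof.
move=> mY; split=> [j|]; first exact: pr_ge0.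
have -> : (1 : R) = pr P setT by rewrite -[pr _ _]/(fine (P setT)) probability_setT.
rewrite -(bigcup_preimage1 Y); apply: pr_bigcup => //.
by move=> i j _ _ [w [<- <-]].
Qed.

Lemma measurable_preimage_nat (Y : {RV P >-> nat}) (A : set nat) :
  measurable (Y @^-1` A).
Proof. by rewrite -[X in measurable X]setTI; exact: measurable_funP. Qed.

Lemma is_law_RV (Y : {RV P >-> nat}) : is_law (law Y).
Proof. by apply: is_law_law => j; exact: measurable_preimage_nat. Qed.

Lemma psum_law (Y : {RV P >-> nat}) n :
  \sum_(0 <= j < n) law Y j = pr P (Y @^-1` [set j | (j < n)%N]).
Proof.
have -> : Y @^-1` [set j | (j < n)%N] = \big[setU/set0]_(j < n) (Y @^-1` [set val j]).
  rewrite -(bigcup_mkord n (fun j => Y @^-1` [set j])).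
  apply/seteqP; split=> [w /= Yw|w [j /= jn]]; first by exists (Y w).
  by rewrite /preimage/= => ->.
rewrite /pr measure_bigsetU_ord//; last 2 first.
- by move=> j; exact: measurable_preimage_nat.
- by move=> i j _ _ [w [/= h1 h2]]; apply/val_inj; exact: etrans (esym h1) h2.
rewrite big_mkord (eq_bigr (fun j : 'I_n => (law Y j)%:E)) ?sumEFin//.
by move=> j _; exact: prE (measurable_preimage_nat _ _).
Qed.

Lemma tail_law (Y : {RV P >-> nat}) x : 0 <= x ->
  tail (realRV Y) x = tl (law Y) x.
Proof.
move=> x0; rewrite /tl psum_law /tail /ccdf /distribution /pushforward.
set A := Y @^-1` _.
have -> : realRV Y @^-1` `]x, +oo[ = ~` A.
  apply/seteqP; split=> w /=; rewrite in_itv/= andbT /realRV /natr_comp.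
    by move=> xY; rewrite /A/= ltnS truncn_ge_nat// leNgt xY.
  by rewrite /A/= ltnS => /negP; rewrite truncn_ge_nat// -ltNge.
by rewrite probability_setC ?(prE P)//; exact: measurable_preimage_nat.
Qed.

Lemma expectation_law (Y : {RV P >-> nat}) :
  'E_P[realRV Y]%E = (\sum_(j <oo) (j%:R * law Y j)%:E)%E.
Proof.
rewrite unlock -(bigcup_preimage1 Y) ge0_integral_bigcup//.
- apply: eq_eseriesr => j _.
  rewrite (eq_integral (cst j%:R%:E)); last first.
    by move=> w; rewrite inE /= => <-.
  rewrite integral_cst; last exact: measurable_preimage_nat.
  by rewrite EFinM -prE//; exact: measurable_preimage_nat.
- by move=> j; exact: measurable_preimage_nat.
- rewrite bigcup_preimage1; apply/measurable_realfun.measurable_EFinP; exact: measurable_funP.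
- by move=> w _; rewrite lee_fin.
- by move=> i j _ _ [w [<- <-]].
Qed.

Lemma expectation_has_mean (Y : {RV P >-> nat}) m : has_mean (law Y) m ->
  mean (realRV Y) = m.
Proof.
move=> Ym; rewrite /mean expectation_law.
have -> : (\sum_(j <oo) (j%:R * law Y j)%:E)%E = m%:E; last by [].
apply: cvg_lim => //.
under eq_fun do rewrite sumEFin.
apply: cvg_EFin; last exact: Ym.
by near=> n.
Unshelve. all: by end_near. Qed.

Lemma has_mean_expectation (Y : {RV P >-> nat}) : ('E_P[realRV Y] < +oo)%E ->
  has_mean (law Y) (mean (realRV Y)).
Proof.
rewrite /mean expectation_law => Yoo.
have law0 j : (0 <= (j%:R * law Y j)%:E)%E.
  by rewrite lee_fin mulr_ge0// pr_ge0.
set S := (\sum_(j <oo) _)%E in Yoo *.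
have S0 : (0 <= S)%E by exact: nneseries_ge0.
have cS : (\sum_(0 <= j < n) (j%:R * law Y j)%:E)%E @[n --> \oo] --> S.
  by apply: is_cvg_nneseries => n _ _; exact: law0.
have fS : S \is a fin_num by rewrite ge0_fin_numE.
rewrite -(fineK fS) in cS.
rewrite /has_mean; have -> : series (fun j => j%:R * law Y j) =
    fine \o (fun n => \sum_(0 <= j < n) (j%:R * law Y j)%:E)%E.
  by apply/funext => n /=; rewrite sumEFin.
exact: fine_cvg.
Qed.

End laws.

(** * Sums of independent integer random variables *)

Section independent_sums.
Context {d : measure_display} {T : measurableType d} {R : realType}
  {P : probability T R} {I : choiceType} (Y : I -> {RV P >-> nat}).
Implicit Types (E : set T) (D : set I) (Z N : T -> nat).
Local Notation pr := (pr P).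
Local Notation law := (law P).

Lemma indep_off_set0 D : indep_off Y D set0.
Proof.
have p0 : pr set0 = 0 by rewrite -[pr _]/(fine (P set0)) measure0.
by split=> // J A _ _; rewrite set0I p0 mul0r.
Qed.

(** Decompose along the value of [Z]. The event [E] is carried along because the
    number of summands will later be fixed by such an event. *)
Lemma indep_off_add D E Z i : (forall z, indep_off Y D (E `&` Z @^-1` [set z])) ->
  ~ D i -> forall u,
  indep_off Y (D `|` [set i]) (E `&` (fun w => Z w + Y i w)%N @^-1` [set u]) /\
  pr (E `&` (fun w => Z w + Y i w)%N @^-1` [set u]) =
    convol (fun z => pr (E `&` Z @^-1` [set z])) (law (Y i)) u.
Proof.
move=> iZ Di u.
(* [F z] is empty for [z > u], so the series below is a finite sum. *)
pose F z := (E `&` Z @^-1` [set z]) `&` Y i @^-1` [set y | (z + y)%N = u].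
have iF z : indep_off Y (D `|` [set i]) (F z) /\
  pr (F z) = pr (E `&` Z @^-1` [set z]) * pr (Y i @^-1` [set y | (z + y)%N = u]).
  exact: indep_off_setI.
have FE : E `&` (fun w => Z w + Y i w)%N @^-1` [set u] = \bigcup_z F z.
  apply/seteqP; split=> [w [Ew /= Zw]|w [z _ [[Ew /= <-] /= Zw]]]; last by split.
  by exists (Z w).
have tF : trivIset setT F by move=> a b _ _ [w [[[_ <-] _] [[_ <-] _]]].
rewrite FE; split; first by apply: indep_off_bigcup => // z; case: (iF z).
have mF z : measurable (F z) by case: (iF z) => -[].
have cF := pr_bigcup (P := P) mF tF.
suff cF' : series (fun z => pr (F z)) @ \oo -->
    convol (fun z => pr (E `&` Z @^-1` [set z])) (law (Y i)) u.
  by rewrite -(cvg_lim _ cF)// -(cvg_lim _ cF').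
apply: cvg_near_cst; exists u.+1 => // n /= un.
rewrite /series/= (@big_cat_nat _ _ _ u.+1)//=.
have -> : \sum_(u.+1 <= z < n) pr (F z) = 0.
  rewrite big_nat big1// => z /andP[uz _]; case: (iF z) => _ ->.
  rewrite (_ : Y i @^-1` _ = set0); last first.
    by apply/seteqP; split=> w //=; lia.
  by rewrite -[X in _ * X]/(fine (P set0)) measure0 mulr0.
rewrite addr0 /convol big_mkord; apply: eq_bigr => -[z /= zu] _.
case: (iF z) => _ ->; congr (_ * pr _).
by apply/seteqP; split=> w /=; lia.
Qed.

Lemma indep_off_sum D E (idx : nat -> I) (p : nat -> R) :
  injective idx -> (forall i, ~ D (idx i)) ->
  (forall i, law (Y (idx i)) =1 p) -> indep_off Y D E -> forall l u,
  let S w := (\sum_(0 <= i < l) Y (idx i) w)%N in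
  indep_off Y (D `|` idx @` `I_l) (E `&` S @^-1` [set u]) /\
  pr (E `&` S @^-1` [set u]) = pr E * convpow p l u.
Proof.
move=> idx_inj Didx Yp iE; elim=> [|l IH] u /=.
  have -> : (fun w => \sum_(0 <= i < 0) Y (idx i) w)%N = (fun=> 0%N).
    by apply/funext => w; rewrite big_nil.
  rewrite [X in E `&` X](_ : _ = if u == 0%N then setT else set0); last first.
    by case: eqP => [->|u0]; apply/seteqP; split=> w //= /esym.
  case: eqP => [_|u0]; rewrite ?setIT ?setI0 ?mulr1 ?mulr0; split=> //.
  - exact: indep_off_sub iE.
  - exact: indep_off_set0.
  - by rewrite -[LHS]/(fine (P set0)) measure0.
have Dl : ~ (D `|` idx @` `I_l) (idx l).
  by move=> [/Didx//|[i /= il /idx_inj ie]]; rewrite ie ltnn in il.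
have -> : (fun w => \sum_(0 <= i < l.+1) Y (idx i) w)%N =
    (fun w => \sum_(0 <= i < l) Y (idx i) w + Y (idx l) w)%N.
  by apply/funext => w; rewrite big_nat_recr.
have [h1 h2] := indep_off_add (fun z => (IH z).1) Dl u; split.
  apply: indep_off_sub h1 => i [[Di|[j /= jl <-]]|->]; first by left.
    by right; exists j => //=; exact: ltnW.
  by right; exists l => /=.
rewrite h2 /convol mulr_sumr; apply: eq_bigr => z _.
by rewrite (IH z).2 Yp mulrA.
Qed.

(** On the event [N = a] the random sum is an ordinary sum of [a] terms,
    independent of that event. *)
Lemma indep_off_random_sum D N (idx : nat -> I) (p : nat -> R) :
  injective idx -> (forall i, ~ D (idx i)) ->
  (forall i, law (Y (idx i)) =1 p) ->
  (forall a, indep_off Y D (N @^-1` [set a])) ->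
  let W w := (\sum_(0 <= i < N w) Y (idx i) w)%N in
  (forall u, indep_off Y (D `|` range idx) (W @^-1` [set u])) /\
  mixture (law N) p (law W).
Proof.
move=> idx_inj Didx Yp iN W.
pose F u a := N @^-1` [set a] `&`
  (fun w => \sum_(0 <= i < a) Y (idx i) w)%N @^-1` [set u].
have FW u : W @^-1` [set u] = \bigcup_a F u a.
  apply/seteqP; split=> [w /= Ww|w [a _ [/= <-]]//].
  by exists (N w).
have tF u : trivIset setT (F u) by move=> a b _ _ [w [[/= <- _] [/= <- _]]].
have iF u a := indep_off_sum idx_inj Didx Yp (iN a) a u.
split=> u.
  rewrite FW; apply: indep_off_bigcup => // a.
  apply: indep_off_sub (iF u a).1 => i [Di|[j _ <-]]; first by left.
  by right; exists j.
have -> : (fun a => law N a * convpow p a u) = (fun a => pr (F u a)).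
  by apply/funext => a; rewrite (iF u a).2.
rewrite /law FW; apply: pr_bigcup => // a.
by case: (iF u a).1.
Qed.

End independent_sums.

(** * Means of convolutions and mixtures *)

Section means.
Context {R : realType}.
Implicit Types (p a b r s : nat -> R) (c : nat -> nat -> R) (m x : R).

(** Tonelli for double arrays of nonnegative reals. *)
Lemma series_exchange c r s (S : R) : (forall i j, 0 <= c i j) ->
  (forall i, series (c i) @ \oo --> s i) -> series s @ \oo --> S ->
  (forall j, series (c ^~ j) @ \oo --> r j) ->
  series r @ \oo --> S.
Proof.
move=> c0 cs sS cr.
have s0 i : 0 <= s i by have := le_psum_lim 0 (c0 i) (cs i); rewrite big_nil.
have r0 j : 0 <= r j by have := le_psum_lim 0 (c0 ^~ j) (cr j); rewrite big_nil.
apply: cvg_psum => // [n|e e0].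
  have cv := cvg_sum_seq (n := n) cr.
  rewrite -(cvg_lim _ cv)//; apply: limr_le; first by apply/cvg_ex; eexists; exact: cv.
  near=> k; rewrite /series/= exchange_big/=.
  apply: (@le_trans _ _ (\sum_(0 <= i < k) s i)); last exact: le_psum_lim.
  by apply: ler_sum => i _; exact: le_psum_lim.
have e2 : 0 < e / 2 by rewrite divr_gt0.
have [k _ /(_ k (leqnn _)) /= sk] := psum_near_lim s0 sS e2.
have /cvgrPdist_le/(_ _ e2)[n _ /(_ n (leqnn _))] := cvg_sum_seq (n := k) cs.
rewrite /= ler_distlC => /andP[cn _]; exists n.
apply: (@le_trans _ _ (\sum_(0 <= i < k) series (c i) n)); first by lra.
rewrite /series/= exchange_big/=.
by apply: ler_sum => j _; exact: le_psum_lim.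
Unshelve. all: by end_near. Qed.

(** [u * (a * b) u] splits along [u = z + (u - z)] into two Cauchy products. *)
Lemma has_mean_convol a b (A B : R) : is_law a -> is_law b ->
  has_mean a A -> has_mean b B -> has_mean (convol a b) (A + B).
Proof.
move=> [a0 a1] [b0 b1] aA bB.
have ja0 j : 0 <= j%:R * a j by rewrite mulr_ge0.
have jb0 j : 0 <= j%:R * b j by rewrite mulr_ge0.
rewrite /has_mean; have -> : series (fun u => u%:R * convol a b u) = fun n =>
    series (convol (fun j => j%:R * a j) b) n
    + series (convol a (fun j => j%:R * b j)) n.
  apply/funext => n; rewrite /series/= -big_split/=; apply: eq_bigr => u _.
  rewrite /convol mulr_sumr -big_split/=; apply: eq_bigr => -[z /= zu] _.
  have -> : u%:R = z%:R + (u - z)%:R :> R by rewrite -natrD subnKC.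
  ring.
rewrite -[A]mulr1 -[B]mul1r.
apply: cvgD; first exact: (series_convol ja0 b0 aA b1).
exact: (series_convol a0 jb0 a1 bB).
Qed.

Lemma has_mean_convpow p m k : is_law p -> has_mean p m ->
  has_mean (convpow p k) (k%:R * m).
Proof.
move=> pl pm; elim: k => [|k IH].
  rewrite mul0r /has_mean (_ : series _ = cst 0); first exact: cvg_cst.
  apply/funext => n; rewrite /series/= big1// => -[|j] _; first by rewrite mul0r.
  by rewrite mulr0.
rewrite -natr1 mulrDl mul1r /=.
exact: has_mean_convol (law_convpow k pl) pl IH pm.
Qed.

Lemma has_mean_mixture pN p r m (mu : R) : is_law pN -> is_law p ->
  mixture pN p r -> has_mean p m -> has_mean pN mu -> has_mean r (mu * m).
Proof.
move=> [pN0 _] pl mr pm pNm.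
apply: (@series_exchange (fun i j => j%:R * (pN i * convpow p i j))
   _ (fun i => pN i * (i%:R * m))) => [i j|i||j].
- by rewrite !mulr_ge0//; case: (law_convpow i pl).
- have -> : series (fun j => j%:R * (pN i * convpow p i j)) =
      fun n => pN i * series (fun j => j%:R * convpow p i j) n.
    by apply/funext => n; rewrite /series/= mulr_sumr; apply: eq_bigr => j _; ring.
  by apply: cvgMr; exact: has_mean_convpow.
- have -> : series (fun i => pN i * (i%:R * m)) =
      fun n => series (fun i => i%:R * pN i) n * m.
    by apply/funext => n; rewrite /series/= mulr_suml; apply: eq_bigr => j _; ring.
  by apply: cvgMl; exact: pNm.
- have -> : series (fun i => j%:R * (pN i * convpow p i j)) =
      fun n => j%:R * series (fun i => pN i * convpow p i j) n.
    by apply/funext => n; rewrite /series/= mulr_sumr.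
  by apply: cvgMr; exact: mr.
Qed.

(** An index above [1] means that doubling the argument divides the tail by more
    than [2], asymptotically; hence the dyadic blocks of the series of the mean
    decay geometrically, with ratio [q]. *)
Lemma regvar_has_mean p beta : is_law p -> regvar (tl p) beta -> 1 < beta ->
  exists m, has_mean p m.
Proof.
move=> pl rp b1; have [p0 _] := pl.
have jp0 j : 0 <= j%:R * p j by rewrite mulr_ge0.
have w1 : 2 `^ (- beta) < 1 / 2 :> R.
  have -> : 2 `^ (- beta) = 1 / 2 * 2 `^ (1 - beta) :> R.
    rewrite mul1r -[in RHS](@powR_inv1 _ 2)// -powRD; last by rewrite pnatr_eq0 implybT.
    by congr (_ `^ _); lra.
  rewrite gtr_pMr; last by rewrite divr_gt0.
  rewrite /powR pnatr_eq0/= expR_lt1 nmulr_rlt0 ?subr_lt0//.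
  by rewrite ln_gt0// ltr1n.
have w0 : 0 < 2 `^ (- beta) :> R by exact: powR_gt0.
set w := 2 `^ (- beta) in w0 w1.
pose e := (1 / 2 - w).
have e0 : 0 < e by rewrite /e; lra.
pose q := 2 * ((1 + e) * w).
have q0 : 0 < q by rewrite /q !mulr_gt0//; lra.
have q1 : q < 1 by rewrite /q /e; nra.
have [M [_ MP]] := asymp_le (rp 2 (ltr0Sn R 1)) e0.
pose x0 := Num.max M 1 + 1.
have x01 : 1 < x0 by rewrite /x0; have : 1 <= Num.max M 1 by [rewrite le_max lexx orbT]; lra.
have Mx0 : M < x0 by rewrite /x0; have : M <= Num.max M 1 by [rewrite le_max lexx]; lra.
pose y k := 2 ^+ k * x0.
have y1 k : x0 <= y k by rewrite /y ler_peMl ?exprn_ege1// ?ler1n//; lra.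
have ty k : y k * tl p (y k) <= q ^+ k * x0.
  elim: k => [|k IH].
    rewrite /y !expr0 !mul1r ler_piMr ?tl_le1//; lra.
  have -> : y k.+1 = 2 * y k by rewrite /y exprS mulrA.
  have yk := lt_le_trans Mx0 (y1 k).
  have y0 : 0 <= 2 * y k by have := y1 k; lra.
  apply: (le_trans (ler_wpM2l y0 (MP _ yk))).
  have -> : 2 * y k * ((1 + e) * (w * tl p (y k))) = q * (y k * tl p (y k)).
    by rewrite /q; ring.
  by rewrite exprS -mulrA ler_wpM2l// ltW.
pose n k := (Num.truncn (y k)).+1.
pose A k := \sum_(0 <= j < n k) j%:R * p j.
pose B := 2 * x0 / (1 - q).
have B0 : 0 <= B by rewrite divr_ge0//; lra.
(* [B] solves [2 x0 + q B = B], which makes the left-hand side nonincreasing. *)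
have AB k : A k + B * q ^+ k <= x0 + B.
  elim: k => [|k IH].
    rewrite expr0 mulr1 lerD2r /A.
    apply: (@le_trans _ _ (\sum_(0 <= j < n 0) x0 * p j)).
      apply: ler_sum_nat => j /andP[_ jn]; rewrite ler_wpM2r//.
      by move: jn; rewrite /n ltnS truncn_ge_nat /y ?expr0 ?mul1r//; lra.
    by rewrite -mulr_sumr ler_piMr ?psum_le1//; lra.
  have yk0 : 0 <= y k by have := y1 k; lra.
  have yk20 : 0 <= 2 * y k by lra.
  have ykS : y k.+1 = 2 * y k by rewrite /y exprS mulrA.
  have nn : (n k <= n k.+1)%N by rewrite /n ltnS le_truncn// ykS; lra.
  have h : \sum_(n k <= j < n k.+1) j%:R * p j <= 2 * (q ^+ k * x0).
    apply: (@le_trans _ _ (2 * (y k * tl p (y k)))); last by rewrite ler_wpM2l.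
    apply: (@le_trans _ _ (2 * y k * \sum_(n k <= j < n k.+1) p j)).
      rewrite mulr_sumr; apply: ler_sum_nat => j /andP[_ jn].
      by rewrite ler_wpM2r//; move: jn; rewrite /n ltnS ykS truncn_ge_nat.
    rewrite mulrA ler_wpM2l//.
    have := psum_le1 (n k.+1) pl; rewrite (@big_cat_nat _ _ _ (n k))//= /tl -/(n k).
    lra.
  have Bq : B * q ^+ k.+1 = B * q ^+ k - 2 * (q ^+ k * x0).
    by rewrite /B exprS; field; lra.
  rewrite /A (@big_cat_nat _ _ _ (n k))//= -/(A k) Bq; lra.
suff cA : cvgn (series (fun j => j%:R * p j)) by eexists; exact: cA.
apply: nondecreasing_is_cvgn; first by move=> i j ij; exact: le_psum.
exists (x0 + B) => _ [k _ <-].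
apply: (@le_trans _ _ (A k)); last first.
  have := AB k; have : 0 <= B * q ^+ k by rewrite mulr_ge0// exprn_ge0// ltW.
  lra.
apply: le_psum => //; rewrite /n leqW// truncn_ge_nat; last first.
  by have := y1 k; lra.
rewrite /y -[leLHS]mulr1; apply: ler_pM => //; last exact: ltW.
by rewrite -natrX ler_nat ltnW// ltn_expl.
Qed.

End means.

(** * The generations of the process *)

Section process.
Context {d : measure_display} {T : measurableType d} {R : realType}
  {P : probability T R}.
Context (X : nat -> {RV P >-> nat}) (xi : nat -> nat -> {RV P >-> nat})
  (eps : nat -> {RV P >-> nat})
  (X_gwi : galton_watson_immigration X xi eps).
Local Notation law := (law P).
Local Notation Y := (gwi_family (X 0%N) xi eps).

(** The variables that determine the first [n] generations; [gwi_family] shifts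
    all indices by one. *)
Definition past n : set (unit + nat * nat + nat) := [set k |
  match k with
  | inl (inl _) => True
  | inl (inr (t, _)) => (t < n)%N
  | inr t => (t < n)%N
  end].

Lemma law_offspring n i : law (xi n.+1 i.+1) =1 law (xi 1%N 1%N).
Proof. by move=> j; congr fine; exact: (gwi_offspring_id X_gwi). Qed.

Lemma law_immigration n : law (eps n.+1) =1 law (eps 1%N).
Proof. by move=> j; congr fine; exact: (gwi_immigration_id X_gwi). Qed.

(** The next generation is a random sum over the offspring indices [(n, i)], plus
    one immigration term, all of them outside [past n]. *)
Lemma generation_step n : (forall a, indep_off Y (past n) (X n @^-1` [set a])) ->
  (forall a, indep_off Y (past n.+1) (X n.+1 @^-1` [set a])) /\
  exists2 r, is_law r & mixture (law (X n)) (law (xi 1%N 1%N)) r /\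
    law (X n.+1) =1 convol r (law (eps 1%N)).
Proof.
move=> iX; pose idx i : unit + nat * nat + nat := inl (inr (n, i)).
have idx_inj : injective idx by move=> i j [].
have Didx i : ~ past n (idx i) by rewrite /past/= ltnn.
pose W w := (\sum_(0 <= i < X n w) Y (idx i) w)%N.
have [iW mW] : (forall u, indep_off Y (past n `|` range idx) (W @^-1` [set u])) /\
    mixture (law (X n)) (law (xi 1%N 1%N)) (law W).
  exact: indep_off_random_sum idx_inj Didx (law_offspring n) iX.
have XW : X n.+1 = (fun w => W w + Y (inr n) w)%N :> (T -> nat).
  apply/funext => w; rewrite (gwi_rec X_gwi)//=; congr (_ + _)%N.
  by rewrite /W big_add1.
have Dn : ~ (past n `|` range idx) (inr n).
  by move=> [|[j _ //]]; rewrite /past/= ltnn.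
have iWT z : indep_off Y (past n `|` range idx) (setT `&` W @^-1` [set z]).
  by rewrite setTI.
have iXa u := indep_off_add iWT Dn u.
split=> [a|].
  have := (iXa a).1; rewrite setTI XW; apply: indep_off_sub.
  move=> k [[|[i _ <-]]|->]; rewrite /past/= ?ltnSn//.
  by case: k => [[//|[t i]]|t]; exact: ltnW.
exists (law W); first by apply: is_law_law => j; case: (iW j).
split=> // u; rewrite XW -[LHS]/(pr P _).
have := (iXa u).2; rewrite setTI => ->; rewrite /convol; apply: eq_bigr => z _.
by rewrite setTI law_immigration.
Qed.

Lemma indep_off_generation n a : indep_off Y (past n) (X n @^-1` [set a]).
Proof.
elim: n a => [|n IH] a; last exact: (generation_step IH).1.
have iT := indep_off_setT set0 (gwi_independent X_gwi).
have D0 : ~ (set0 : set (unit + nat * nat + nat)) (inl (inl tt)) by [].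
have := (@indep_off_setI _ _ _ _ _ _ _ _ _ _ (inl (inl tt)) [set a] iT D0 _).1.
rewrite setTI => /(_ Logic.I); apply: indep_off_sub => k [//|->//].
Qed.

End process.

(** * The coefficients of the tail equivalence *)

Section coefficients.
Context {R : realType}.
Context (m beta : R) (m_gt0 : 0 < m).

(** The weight of the offspring tail [k] generations after one individual is
    present: the large family may occur in any of the [k] generations. *)
Definition geom_coef k := m ^+ (k - 1) * \sum_(0 <= i < k) m `^ (i%:R * (beta - 1)).

Lemma geom_coefS k : geom_coef k.+1 = m ^+ k + m `^ beta * geom_coef k.
Proof.
have pD a b : m `^ (a + b) = m `^ a * m `^ b.
  by apply: powRD; rewrite (gt_eqF m_gt0) implybT.
rewrite /geom_coef subn1 /= big_nat_recl//= mul0r powRr0 mulrDr mulr1.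
congr (_ + _); case: k => [|k]; first by rewrite !big_nil !mulr0.
rewrite subn1/= mulrCA exprSr -mulrA; congr (_ * _).
rewrite !mulr_sumr; apply: eq_bigr => i _.
rewrite -[X in X * _](powRr1 (ltW m_gt0)) -!pD.
by congr (_ `^ _); rewrite -natr1; ring.
Qed.

End coefficients.

Section closed_form.
Context {R : realType}.
Context (m beta m0 me : R) (F X0 E : R -> R).

Definition gwi_mean n := m0 * m ^+ n + me * \sum_(1 <= j < n.+1) m ^+ (n - j).

Lemma gwi_meanS n : gwi_mean n.+1 = gwi_mean n * m + me.
Proof.
rewrite /gwi_mean big_nat_recr//= subnn expr0 mulrDl exprSr mulrA -addrA.
congr (_ + _); rewrite mulrDr mulr1 -mulrA; congr (me * _ + _).
rewrite mulr_suml; apply: eq_big_nat => j /andP[_ jn].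
by rewrite subSn// exprSr.
Qed.

Definition gwi_tail n x :=
  m0 * m ^+ (n - 1) * (\sum_(0 <= i < n) m `^ (i%:R * (beta - 1))) * F x
  + m `^ (n%:R * beta) * X0 x
  + me * (\sum_(1 <= j < n) m ^+ (n - j - 1)
       * \sum_(0 <= i < n - j) m `^ (i%:R * (beta - 1))) * F x
  + (\sum_(1 <= j < n.+1) m `^ ((n - j)%:R * beta)) * E x.

(** One generation multiplies the tail by [m `^ beta], and adds one offspring
    tail for each of the [gwi_mean n] expected parents and one immigration
    tail. *)
Lemma gwi_tailS n x : 0 < m ->
  gwi_tail n.+1 x = (gwi_mean n * F x + m `^ beta * gwi_tail n x) + E x.
Proof.
move=> m_gt0; have mN0 : m != 0 by rewrite gt_eqF.
have pD k : m `^ (k.+1%:R * beta) = m `^ beta * m `^ (k%:R * beta).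
  by rewrite -powRD; [|by rewrite mN0 implybT]; congr (_ `^ _); rewrite -natr1; ring.
rewrite /gwi_tail -!(mulrA m0) -![_ * \sum_(0 <= i < _) _]/(geom_coef m beta _).
under eq_bigr => j _ do rewrite -[_ * _]/(geom_coef m beta (n.+1 - j)).
under [in RHS]eq_bigr => j _ do rewrite -[_ * _]/(geom_coef m beta (n - j)).
rewrite geom_coefS// pD.
have -> : \sum_(1 <= j < n) geom_coef m beta (n - j) =
    \sum_(1 <= j < n.+1) geom_coef m beta (n - j).
  case: n => [|n]; first by rewrite !big_geq.
  by rewrite [RHS]big_nat_recr//= subnn /geom_coef big_nil mulr0 addr0.
have -> : \sum_(1 <= j < n.+1) geom_coef m beta (n.+1 - j) =
    \sum_(1 <= j < n.+1) m ^+ (n - j)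
    + m `^ beta * \sum_(1 <= j < n.+1) geom_coef m beta (n - j).
  rewrite mulr_sumr -big_split/=; apply: eq_big_nat => j /andP[_ jn].
  by rewrite subSn// geom_coefS.
have -> : \sum_(1 <= j < n.+2) m `^ ((n.+1 - j)%:R * beta) =
   m `^ beta * \sum_(1 <= j < n.+1) m `^ ((n - j)%:R * beta) + 1.
  rewrite big_nat_recr//= subnn mul0r powRr0 mulr_sumr; congr (_ + _).
  by apply: eq_big_nat => j /andP[_ jn]; rewrite subSn// pD.
rewrite /gwi_mean; ring.
Qed.

End closed_form.

(** * From random variables to laws and back *)

Section regular_variation_of_laws.
Context {d : measure_display} {T : measurableType d} {R : realType}
  {P : probability T R}.
Implicit Types (Y : {RV P >-> nat}) (beta x : R).

Lemma near_tail_law Y : \forall x \near +oo, tail (realRV Y) x = tl (law P Y) x.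
Proof.
near=> x; apply: tail_law.
by near: x; apply: nbhs_pinfty_ge; exact: num_real.
Unshelve. all: by end_near. Qed.

Lemma asymp_tail_law Y : asymp (tail (realRV Y)) (tl (law P Y)).
Proof.
apply: (@asymp_near _ (tl (law P Y))).
  by move: (near_tail_law Y); apply: filterS => x ->.
by apply: asymp_refl; near=> x; exact: tl_ge0 (is_law_RV Y).
Unshelve. all: by end_near. Qed.

Lemma regularly_varying_law Y beta : regularly_varying (realRV Y) beta ->
  (forall x, 0 < tl (law P Y) x) /\ regvar (tl (law P Y)) beta.
Proof.
move=> [_ _ t0 tq]; split=> [x|].
  have x1 : 0 < Num.max x 1 by rewrite lt_max ltr01 orbT.
  apply: (@lt_le_trans _ _ (tl (law P Y) (Num.max x 1))).
    by rewrite -tail_law ?ltW//; exact: t0.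
  by apply: tl_nonincr; [exact: is_law_RV|rewrite le_max lexx].
apply: regvar_asymp (asymp_sym (asymp_tail_law Y)) _.
apply/regvarP => //; near=> x; apply: t0.
by near: x; apply: nbhs_pinfty_gt; exact: num_real.
Unshelve. all: by end_near. Qed.

Lemma law_regularly_varying Y beta : 0 <= beta ->
  (forall x, 0 < tl (law P Y) x) -> regvar (tl (law P Y)) beta ->
  regularly_varying (realRV Y) beta.
Proof.
move=> b0 t0 rY.
have tx0 x : 0 < x -> 0 < tail (realRV Y) x.
  by move=> x0; rewrite tail_law ?ltW.
split=> [//|w|x x0|]; [exact: ler0n|exact: tx0|].
apply/regvarP; last exact: regvar_asymp (asymp_tail_law Y) rY.
near=> x; apply: tx0.
by near: x; apply: nbhs_pinfty_gt; exact: num_real.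
Unshelve. all: by end_near. Qed.

Lemma regularly_varying_has_mean Y beta : regularly_varying (realRV Y) beta ->
  1 <= beta -> (beta = 1 -> ('E_P[realRV Y] < +oo)%E) ->
  has_mean (law P Y) (mean (realRV Y)).
Proof.
move=> rY b1 Yoo; have [t0 rtY] := regularly_varying_law rY.
have [b1'|b1'] := eqVneq beta 1.
  exact: has_mean_expectation (Yoo b1').
have b1lt : 1 < beta by rewrite lt_neqAle eq_sym b1' b1.
have [m mY] := regvar_has_mean (is_law_RV Y) rtY b1lt.
by rewrite (expectation_has_mean mY).
Qed.

End regular_variation_of_laws.

(** Induction on the generation. The mean and the positivity of the tail are part
    of the induction because the next random sum needs them. *)
Lemma gwi_asymp (d : measure_display) (T : measurableType d)
  (R : realType) (P : probability T R)
  (X : nat -> {RV P >-> nat}) (xi : nat -> nat -> {RV P >-> nat})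
  (eps : nat -> {RV P >-> nat}) (beta m m0 me : R)
  (F := tl (law P (xi 1%N 1%N))) (X0 := tl (law P (X 0%N)))
  (E := tl (law P (eps 1%N))) :
  galton_watson_immigration X xi eps ->
  (forall x, 0 < X0 x) -> regvar X0 beta -> has_mean (law P (X 0%N)) m0 ->
  (forall x, 0 < F x) -> regvar F beta -> has_mean (law P (xi 1%N 1%N)) m ->
  regvar E beta -> has_mean (law P (eps 1%N)) me ->
  forall n, let f := gwi_tail m beta m0 me F X0 E n in
  [/\ has_mean (law P (X n)) (gwi_mean m m0 me n),
      forall x, 0 < tl (law P (X n)) x,
      regvar f beta & asymp (tl (law P (X n))) f].
Proof.
move=> X_gwi X0_gt0 rX0 mX0 F_gt0 rF mF rE mE.
have lF : is_law (law P (xi 1%N 1%N)) by exact: is_law_RV.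
have lE : is_law (law P (eps 1%N)) by exact: is_law_RV.
have m_gt0 := has_mean_gt0 lF F_gt0 mF.
have EE : asymp E E by apply: asymp_refl; near=> x; exact: tl_ge0.
elim=> [|n [mXn Xn_gt0 rf Xf]] f.
  have fX0 : f =1 X0.
    move=> x; rewrite /f /gwi_tail !big_geq// !mulr0 !mul0r powRr0.
    by rewrite mul1r add0r !addr0.
  rewrite (funext fX0); split=> //.
    by rewrite /gwi_mean expr0 big_geq// mulr0 mulr1 addr0.
  by apply: asymp_refl; near=> x; exact: ltW.
have lXn := is_law_RV (X n).
have [_ [r lr [mr Xr]]] := generation_step X_gwi (indep_off_generation X_gwi n).
have rXn := regvar_asymp Xf rf.
have trf := asymp_tl_random_sum lXn lF mr Xn_gt0 F_gt0 rXn rF mF mXn.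
have mr' := has_mean_mixture lXn lF mr mF mXn.
have mu0 := has_mean_gt0 lXn Xn_gt0 mXn.
set g := fun x => gwi_mean m m0 me n * F x
   + m `^ beta * gwi_tail m beta m0 me F X0 E n x.
have rg : regvar g beta.
  by apply: regvarD; apply: regvarZ => //; [exact: ltW|exact: powR_ge0].
have tg : asymp (tl r) g.
  apply: asymp_trans trf _; apply: asympD.
    by apply: asymp_refl; near=> x; rewrite mulr_ge0// ltW// F_gt0.
  by apply: asympZ => //; exact: powR_ge0.
have fE : f =1 (fun x => g x + E x) by move=> x; exact: gwi_tailS.
have tX : tl (law P (X n.+1)) =1 tl (convol r (law P (eps 1%N))).
  by move=> x; rewrite /tl; congr (1 - _); apply: eq_bigr => j _; exact: Xr.
have Xf' : asymp (tl (law P (X n.+1))) f.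
  rewrite (funext fE) (funext tX).
  exact: asymp_tl_convol rg rE tg EE.
split=> //.
- rewrite gwi_meanS (funext Xr).
  exact: has_mean_convol.
- apply: tl_gt0_near; first exact: is_law_RV.
  have h2 : (0 : R) < 1 / 2 by rewrite divr_gt0.
  near=> x; apply: (@lt_le_trans _ _ ((1 - 1 / 2) * f x)); last first.
    by near: x; exact: asymp_ge Xf' h2.
  rewrite fE mulr_gt0//; first by lra.
  rewrite /g -addrA ltr_wpDr//; last by rewrite mulr_gt0// F_gt0.
  rewrite addr_ge0 ?tl_ge0// mulr_ge0 ?powR_ge0//.
  by near: x; exact: asymp_ge0 Xf.
- by rewrite (funext fE); exact: regvarD.
Unshelve. all: by end_near. Qed.

(** * The theorem *)

Unset Implicit Arguments.
Theorem proposition2p7 (d : measure_display) (T : measurableType d)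
  (R : realType) (P : probability T R)
  (X : nat -> {RV P >-> nat}) (xi : nat -> nat -> {RV P >-> nat})
  (eps : nat -> {RV P >-> nat}) (beta : R)
  (X_gwi : galton_watson_immigration X xi eps)
  (beta_ge1 : 1 <= beta)
  (X0_rv : regularly_varying (realRV (X 0%N)) beta)
  (xi_rv : regularly_varying (realRV (xi 1%N 1%N)) beta)
  (eps_rv : regularly_varying (realRV (eps 1%N)) beta)
  (xi_O_X0 : asymp_bigO (tail (realRV (xi 1%N 1%N))) (tail (realRV (X 0%N))))
  (xi_O_eps : asymp_bigO (tail (realRV (xi 1%N 1%N))) (tail (realRV (eps 1%N))))
  (beta1_means : beta = 1 ->
    [/\ (0 < 'E_P[realRV (X 0%N)] < +oo)%E,
        (0 < 'E_P[realRV (xi 1%N 1%N)] < +oo)%E &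
        (0 <= 'E_P[realRV (eps 1%N)] < +oo)%E])
  (n : nat) (n_gt0 : (0 < n)%N) :
  let m_X0 := mean (realRV (X 0%N)) in
  let m_xi := mean (realRV (xi 1%N 1%N)) in
  let m_eps := mean (realRV (eps 1%N)) in
  asymp_equiv (tail (realRV (X n)))
    (fun x =>
       m_X0 * m_xi ^+ (n - 1)
         * (\sum_(0 <= i < n) m_xi `^ (i%:R * (beta - 1)))
         * tail (realRV (xi 1%N 1%N)) x
     + m_xi `^ (n%:R * beta) * tail (realRV (X 0%N)) x
     + m_eps
         * (\sum_(1 <= j < n)
              m_xi ^+ (n - j - 1)
                * \sum_(0 <= i < n - j) m_xi `^ (i%:R * (beta - 1)))
         * tail (realRV (xi 1%N 1%N)) x
     + (\sum_(1 <= j < n.+1) m_xi `^ ((n - j)%:R * beta))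
         * tail (realRV (eps 1%N)) x)
  /\ regularly_varying (realRV (X n)) beta.

Proof.
move=> m_X0 m_xi m_eps.
have [X0_gt0 rX0] := regularly_varying_law X0_rv.
have [F_gt0 rF] := regularly_varying_law xi_rv.
have [E_gt0 rE] := regularly_varying_law eps_rv.
have mX0 : has_mean (law P (X 0%N)) m_X0.
  by apply: regularly_varying_has_mean X0_rv _ _ => // /beta1_means[/andP[]].
have mF : has_mean (law P (xi 1%N 1%N)) m_xi.
  by apply: regularly_varying_has_mean xi_rv _ _ => // /beta1_means[_ /andP[]].
have mE : has_mean (law P (eps 1%N)) m_eps.
  by apply: regularly_varying_has_mean eps_rv _ _ => // /beta1_means[_ _ /andP[]].
have [_ Xn_gt0 rf Xf] := gwi_asymp X_gwi X0_gt0 rX0 mX0 F_gt0 rF mF rE mE n.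
split; last first.
  apply: law_regularly_varying => //; first by apply: le_trans beta_ge1.
  exact: regvar_asymp Xf rf.
apply: eq_asymp_equiv; last first.
- apply/asymp_equivP; last exact: Xf.
  have h2 : (0 : R) < 1 by [].
  near=> x.
  have : tl (law P (X n)) x <= (1 + 1) * gwi_tail m_xi beta m_X0 m_eps
      (tl (law P (xi 1%N 1%N))) (tl (law P (X 0%N))) (tl (law P (eps 1%N))) n x.
    by near: x; exact: asymp_le Xf h2.
  by have := Xn_gt0 x; lra.
- near=> x; rewrite /gwi_tail -!tail_law//; near: x; apply: nbhs_pinfty_ge;
    exact: num_real.
- by move: (near_tail_law (X n)); apply: filterS => x ->.
Unshelve. all: by end_near. Qed.
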